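(* Fix an integer $k>0$. Let $0<\ell\le k$ and let $\lambda,\nu$ be $(k+1)$-cores. Then $(k+\lambda_1,\lambda)/\nu$ is a bottom strong $\ell$-strip if and only if $\nu/\lambda$ is a weak $\ell$-strip.
   Context: Partitions $\lambda=(\lambda_1\ge\lambda_2\ge\cdots)$ are identified with their Ferrers diagrams in French notation: row $i$ (counted from the bottom, $i=1,2,\dots$) consists of the cells $(i,j)$, $1\le j\le\lambda_i$. For partitions $\mu\subseteq\lambda$, the skew shape $\lambda/\mu$ is the set of cells of $\lambda$ not in $\mu$; it is a horizontal strip if no two of its cells lie in the same column. The hook length of a cell is the number of cells to its right in its row plus the number of cells above it in its column plus one. A $(k+1)$-core is a partition having no cell of hook length exactly $k+1$. The content of cell $(i,j)$ is $j-i$ and its residue is $(j-i)\bmod (k+1)$. For a $(k+1)$-core $\lambda$, $\deg(\lambda)$ is the number of cells of $\lambda$ with hook length smaller than $k+1$. For a partition $\lambda$, $(k+\lambda_1,\lambda)$ denotes the partition $(k+\lambda_1,\lambda_1,\lambda_2,\dots)$, i.e. $\lambda$ with a new bottom row of length $k+\lambda_1$ inserted below it. Weak order on $(k+1)$-cores: $\beta\lessdot\gamma$ iff $\gamma\neq\beta$ and $\gamma$ is obtained from $\beta$ by adding all addable cells (corners) of $\beta$ of one fixed residue. Strong order on $(k+1)$-cores: $\rho\lessdot_B\gamma$ iff $\rho\subseteq\gamma$ and $\deg(\gamma)=\deg(\rho)+1$. Weak $\ell$-strip: for $(k+1)$-cores $\lambda,\nu$, the skew shape $\nu/\lambda$ is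 a weak $\ell$-strip if there is a chain of cores $\lambda=\gamma^0\lessdot\gamma^1\lessdot\cdots\lessdot\gamma^\ell=\nu$ in weak order such that $\nu/\lambda$ is a horizontal strip and, for all $i=1,\dots,\ell-1$, the rightmost cell of $\gamma^i/\gamma^{i-1}$ lies in a column strictly to the left of the rightmost cell of $\gamma^{i+1}/\gamma^i$. Bottom strong $\ell$-strip: for $(k+1)$-cores $\lambda,\nu$, the skew shape $(k+\lambda_1,\lambda)/\nu$ is a bottom strong $\ell$-strip if there is a chain of cores $\nu=\nu^0\lessdot_B\nu^1\lessdot_B\cdots\lessdot_B\nu^{k-\ell}=(k+\lambda_1,\lambda)$ in strong order such that (1) $(k+\lambda_1,\lambda)/\nu$ is a horizontal strip, and (2) for each $1\le i\le k-\ell$, the rightmost cell of the bottom row (row 1) of $\nu^i$ is a cell of $\nu^i/\nu^{i-1}$. *)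

(* Defs.v *)
From HB Require Import structures.
From mathcomp Require Import all_boot all_order all_algebra.

Set Implicit Arguments.
Unset Strict Implicit.
Unset Printing Implicit Defensive.

(* Rows and columns are numbered from 0 (the bottom row is row 0); contents,
   residues and hook lengths are the same as with numbering from 1. *)
Notation cell := (nat * nat)%type.

Definition is_partition (s : seq nat) : bool := sorted geq s && (0 \notin s).

Definition cells (s : seq nat) : seq cell :=
  [seq (i, j) | i <- iota 0 (size s), j <- iota 0 (nth 0 s i)].

Lemma mem_cells (s : seq nat) (c : cell) :
  (c \in cells s) = (c.2 < nth 0 s c.1).
Proof.
case: c => i j /=; apply/allpairsPdep/idP => [[i' [j' []]]|lt_j].
  by rewrite !mem_iota !add0n => _ /= lt_j [-> ->].
exists i, j; rewrite !mem_iota !add0n; split=> //=.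
by rewrite ltnNge; apply/negP => le_si; rewrite nth_default in lt_j.
Qed.

Definition contained (mu la : seq nat) : Prop := {subset cells mu <= cells la}.

Definition skew (la mu : seq nat) : seq cell :=
  [seq c <- cells la | c \notin cells mu].

Definition horizontal_strip (la mu : seq nat) : Prop :=
  contained mu la /\
  forall c d : cell, c \in skew la mu -> d \in skew la mu -> c.2 = d.2 -> c = d.

Definition arm (s : seq nat) (c : cell) : nat :=
  count (fun d : cell => (d.1 == c.1) && (c.2 < d.2)) (cells s).

Definition leg (s : seq nat) (c : cell) : nat :=
  count (fun d : cell => (d.2 == c.2) && (c.1 < d.1)) (cells s).

Definition hook_length (s : seq nat) (c : cell) : nat := arm s c + leg s c + 1.

Definition is_core (n : nat) (s : seq nat) : bool :=
  is_partition s && all (fun c => hook_length s c != n) (cells s).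

Definition residue (k : nat) (c : cell) : int :=
  ((c.2%:Z - c.1%:Z)%R %% k.+1%:Z)%Z.

Definition deg (k : nat) (s : seq nat) : nat :=
  count (fun c => hook_length s c < k.+1) (cells s).

Definition add_bottom_row (k : nat) (la : seq nat) : seq nat :=
  (k + nth 0 la 0) :: la.

Definition addable (s : seq nat) (c : cell) : Prop :=
  c \notin cells s /\
  exists t : seq nat, is_partition t /\ cells t =i c :: cells s.

Definition weak_cover (k : nat) (be ga : seq nat) : Prop :=
  ga <> be /\
  exists r : int, forall c : cell,
    c \in cells ga <-> c \in cells be \/ (addable be c /\ residue k c = r).

Definition strong_cover (k : nat) (rho ga : seq nat) : Prop :=
  contained rho ga /\ deg k ga = deg k rho + 1.

(* Only meaningful for nonempty S; the skew shape of a weak cover never is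
   empty. *)
Definition rightmost_column (S : seq cell) : nat := \max_(c <- S) c.2.

(* The skew shape nu / la; the entries of the chain beyond index l are
   irrelevant. *)
Definition weak_strip (k l : nat) (nu la : seq nat) : Prop :=
  exists ga : nat -> seq nat,
    [/\ ga 0 = la /\ ga l = nu,
        forall i, i <= l -> is_core k.+1 (ga i),
        forall i, i < l -> weak_cover k (ga i) (ga i.+1),
        horizontal_strip nu la &
        forall i, 1 <= i <= l.-1 ->
          rightmost_column (skew (ga i) (ga i.-1))
            < rightmost_column (skew (ga i.+1) (ga i))].

(* The skew shape (k + la_1, la) / nu. The rightmost cell of the bottom row of
   a nonempty s is (0, (nth 0 s 0).-1); for empty s that cell is not in s, so
   the last condition fails. *)
Definition bottom_strong_strip (k l : nat) (la nu : seq nat) : Prop :=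
  exists rho : nat -> seq nat,
    [/\ rho 0 = nu /\ rho (k - l) = add_bottom_row k la,
        forall i, i <= k - l -> is_core k.+1 (rho i),
        forall i, i < k - l -> strong_cover k (rho i) (rho i.+1),
        horizontal_strip (add_bottom_row k la) nu &
        forall i, 1 <= i <= k - l ->
          (0, (nth 0 (rho i) 0).-1) \in skew (rho i) (rho i.-1)].

(* Main.v *)
Require Import Defs.
From mathcomp Require Import all_boot all_order all_algebra.
From mathcomp Require Import zify.

Set Implicit Arguments.
Unset Strict Implicit.
Unset Printing Implicit Defensive.

Import Order.TTheory GRing.Theory Num.Theory Defs.
Open Scope ring_scope.

(** Encode a partition by its beads, the positions [s_i - i - 1]. With
    [n = k + 1], a partition is an [n]-core iff its bead set is closed under
    subtracting [n], i.e. iff every residue class mod [n] is a flush runner, and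
    a horizontal strip is an interlacing of bead sequences.

    Cut [Z/n] into cyclic blocks such that, in [la], the first runner of each
    block is strictly higher than the other runners of that block, and rotate
    every block: the first runner moves to the end, the others move down by one.
    Both kinds of strips turn out to be exactly the passages from [la] to such a
    rotation [nu] with [n - l] blocks.

    Weak strips: a weak cover exchanges two adjacent runners. In a weak strip no
    position can be reoccupied after it was vacated, so residue [r] is added at
    most once and never before [r - 1]; hence each cover merges a block with the
    following singleton block. Conversely the residues of a rotation are added in
    the order of their top contents.

    Strong strips: [(k + la_1, la)] is the rotation with a single block, ending
    just before the top bead of [la]. If [ga / rho] is a horizontal strip of
    cores, then [deg ga - deg rho] is a sum over the rows of nonnegative integers,
    and every chain of moved beads along a runner contributes at least one. So a
    strong cover with growing bottom row exchanges the top runner with one other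
    runner, which splits the first block in two. *)

(** * Partitions and beads *)

Definition bd (s : seq nat) (i : nat) : int := (nth 0%N s i)%:Z - i%:Z - 1.

Lemma partition_nth_geq (s : seq nat) (i j : nat) :
  is_partition s -> (i <= j)%N -> (nth 0 s j <= nth 0 s i)%N.
Proof.
move=> /andP[srt _] le_ij; have [lt_j|ge_j] := ltnP j (size s); last first.
  by rewrite (nth_default _ ge_j).
have tr : transitive geq by move=> a b c /= ab bc; exact: leq_trans bc ab.
have rf : reflexive geq by move=> a /=.
apply: (sorted_leq_nth tr rf 0%N srt) => //; rewrite inE //.
exact: leq_ltn_trans lt_j.
Qed.

Lemma partition_nth_gt0 (s : seq nat) (i : nat) :
  is_partition s -> (0 < nth 0 s i)%N = (i < size s)%N.
Proof.
move=> /andP[_ n0]; have [lt_i|ge_i] := ltnP i (size s); last by rewrite nth_default.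
by rewrite lt0n; apply: contraNneq n0 => <-; rewrite mem_nth.
Qed.

Lemma partition_eq (s t : seq nat) :
  is_partition s -> is_partition t -> nth 0%N s =1 nth 0%N t -> s = t.
Proof.
move=> ps pt E; apply: (@eq_from_nth _ 0%N) => // .
have H i : (i < size s)%N = (i < size t)%N.
  by rewrite -!partition_nth_gt0 // E.
by apply/eqP; rewrite eqn_leq leqNgt H ltnn leqNgt -H ltnn.
Qed.

Lemma partition_exists (b : nat -> nat) (M : nat) :
  (forall i, b i.+1 <= b i)%N -> b M = 0%N ->
  exists2 t, is_partition t & forall i, nth 0%N t i = b i.
Proof.
move=> dec bM; have exM : exists m, b m == 0%N by exists M; rewrite bM.
case: (ex_minnP exM) => m /eqP bm0 minm.
have mono i j : (i <= j)%N -> (b j <= b i)%N.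
  by move/subnK<-; elim: (j - i)%N => // d IH; exact: leq_trans (dec _) IH.
have nthE i : nth 0%N (mkseq b m) i = b i.
  have [lt_i|ge_i] := ltnP i m; first by rewrite nth_mkseq.
  by rewrite nth_default ?size_mkseq //; have := mono _ _ ge_i; lia.
exists (mkseq b m) => //; apply/andP; split.
  apply/(sortedP 0%N) => i; rewrite size_mkseq => lt_i.
  by rewrite /= !nthE.
apply/negP => /(nthP 0%N)[i]; rewrite size_mkseq => lt_i; rewrite nthE => b0.
by have := minm i; rewrite b0 eqxx; lia.
Qed.

Lemma bd_ltn (s : seq nat) (i j : nat) :
  is_partition s -> (i < j)%N -> bd s j < bd s i.
Proof.
by move=> ps lt; have := partition_nth_geq ps (ltnW lt); rewrite /bd; lia.
Qed.

Lemma bd_leq (s : seq nat) (i j : nat) :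
  is_partition s -> (i <= j)%N -> bd s j <= bd s i.
Proof.
by move=> ps lt; have := partition_nth_geq ps lt; rewrite /bd; lia.
Qed.

Lemma bd_lt_idx (s : seq nat) (i j : nat) :
  is_partition s -> bd s j < bd s i -> (i < j)%N.
Proof. by move=> ps lt; case: ltnP => // /(bd_leq ps); lia. Qed.

Lemma bd_inj (s : seq nat) : is_partition s -> injective (bd s).
Proof.
move=> ps i j E; case: (ltngtP i j) => // /(bd_ltn ps); lia.
Qed.

Lemma bd_default (s : seq nat) (i : nat) : (size s <= i)%N -> bd s i = - i%:Z - 1.
Proof. by move=> h; rewrite /bd nth_default //; lia. Qed.

Lemma row_exists (s : seq nat) (x : int) : exists i, bd s i <= x.
Proof.
exists (size s + `|x|)%N; rewrite bd_default ?leq_addr //; lia.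
Qed.

(** The only candidate for a row whose bead is at [x]; it makes [bead] a boolean test. *)
Definition row (s : seq nat) (x : int) : nat := ex_minn (row_exists s x).

Lemma row_le (s : seq nat) (x : int) : bd s (row s x) <= x.
Proof. by rewrite /row; case: ex_minnP. Qed.

Lemma lt_row (s : seq nat) (x : int) (i : nat) : (i < row s x)%N -> x < bd s i.
Proof.
rewrite /row; case: ex_minnP => m _ minm lt_i; rewrite ltNge; apply/negP => h.
by have := minm _ h; lia.
Qed.

Definition bead (s : seq nat) (x : int) : bool := bd s (row s x) == x.

Lemma bead_bd (s : seq nat) (i : nat) : is_partition s -> bead s (bd s i).
Proof.
move=> ps; apply/eqP; have h := row_le s (bd s i).
have [lt|gt|->//] := ltngtP (row s (bd s i)) i.
  by have := bd_ltn ps lt; lia.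
by have := lt_row gt; lia.
Qed.

Lemma beadP (s : seq nat) (x : int) : bead s x -> exists i, x = bd s i.
Proof. by move=> /eqP; exists (row s x). Qed.

Lemma bead_le_top (s : seq nat) (x : int) : is_partition s -> bead s x -> x <= bd s 0.
Proof. by move=> ps /beadP[i ->]; exact: bd_leq. Qed.

Lemma bead_between (s : seq nat) (i : nat) (x : int) :
  is_partition s -> bd s i.+1 < x -> x < bd s i -> bead s x = false.
Proof.
move=> ps h1 h2; apply/negP => /beadP[j E]; subst x.
by have := bd_lt_idx ps h1; have := bd_lt_idx ps h2; lia.
Qed.

Lemma bead_eq (s t : seq nat) :
  is_partition s -> is_partition t -> bead s =1 bead t -> s = t.
Proof.
move=> ps pt E; apply: partition_eq => // i.
suff: bd s i = bd t i by rewrite /bd; lia.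
elim/ltn_ind: i => i IH.
(* The bead of row [i] is the largest one left after the earlier rows, and by symmetry one
   inequality suffices. *)
have aux a b : is_partition a -> is_partition b -> bead a =1 bead b ->
    (forall j, (j < i)%N -> bd a j = bd b j) -> bd a i <= bd b i.
  move=> pa pb Eab IHab; have := bead_bd i pa; rewrite Eab => /beadP[j Ej].
  have [lt_j|ge_j] := ltnP j i; last by rewrite Ej; exact: bd_leq.
  by have := bd_ltn pa lt_j; rewrite (IHab _ lt_j); lia.
apply: le_anti; apply/andP; split; apply: aux => // j ?; by rewrite IH.
Qed.

(** * Containment and horizontal strips *)

Lemma containedP (mu la : seq nat) :
  contained mu la <-> forall i, bd mu i <= bd la i.
Proof.
split=> [H i|H [i j]]; last first.
  by rewrite !mem_cells /=; have := H i; rewrite /bd; lia.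
rewrite /bd; case E: (nth 0%N mu i) => [|m]; first lia.
have := H (i, m); rewrite !mem_cells /= E => /(_ (ltnSn _)); lia.
Qed.

Lemma mem_skew (la mu : seq nat) (c : cell) :
  (c \in skew la mu) = (nth 0 mu c.1 <= c.2 < nth 0 la c.1)%N.
Proof. by rewrite mem_filter !mem_cells -leqNgt. Qed.

(** For the parts this reads [la_i <= nu_i] and [nu_(i+1) <= la_i]; the second inequality becomes
    strict because the row index enters [bd]. *)
Definition interlace (la nu : seq nat) : Prop :=
  forall i, bd la i <= bd nu i /\ bd nu i.+1 < bd la i.

Lemma horizontal_stripP (la mu : seq nat) :
  is_partition la -> is_partition mu ->
  horizontal_strip la mu <-> interlace mu la.
Proof.
move=> pl pm; split=> [[/containedP sub inj] i|H].
  split=> //; rewrite ltNge; apply/negP => le_i.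
  have h0 := sub i; have h1 := sub i.+1.
  have h2 := partition_nth_geq pl (leqnSn i).
  have h3 := partition_nth_geq pm (leqnSn i).
  (* If [la_(i+1) > mu_i], the column [mu_i] has cells of the skew shape in both rows [i] and
     [i + 1]. *)
  have := inj (i, nth 0%N mu i) (i.+1, nth 0%N mu i).
  rewrite !mem_skew /=.
  have -> : (nth 0 mu i <= nth 0 mu i < nth 0 la i)%N by move: h0 h1 le_i; rewrite /bd; lia.
  have -> : (nth 0 mu i.+1 <= nth 0 mu i < nth 0 la i.+1)%N.
    by move: h0 h1 le_i; rewrite /bd; lia.
  by move=> /(_ isT isT erefl)[]; lia.
split; first by apply/containedP => i; case: (H i).
move=> [i j] [i' j']; rewrite !mem_skew /= => hi hi' E; subst j'.
have aux a b : (a < b)%N -> (nth 0 la b <= nth 0 mu a)%N.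
  move=> lt; have := partition_nth_geq pl lt; have [_] := H a.
  by rewrite /bd; lia.
have [lt|lt|->//] := ltngtP i i'; have := aux _ _ lt; lia.
Qed.

(** * Hook lengths, cores and degree *)

Lemma count_geq_iota (a m : nat) : count (leq a) (iota 0 m) = (m - a)%N.
Proof.
elim: m => // m IH; rewrite -addn1 iotaD count_cat IH /= add0n; lia.
Qed.

Lemma count_range_iota (a b m : nat) :
  count (fun i => (a <= i < b)%N) (iota 0 m) = (minn b m - a)%N.
Proof.
elim: m => [|m IH]; first by rewrite minn0.
rewrite -addn1 iotaD count_cat IH /= add0n; lia.
Qed.

Lemma count_cells (P : pred cell) (s : seq nat) (M : nat) : (size s <= M)%N ->
  count P (cells s) =
    (\sum_(0 <= i < M) count (fun j => P (i, j)) (iota 0 (nth 0 s i)))%N.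
Proof.
move=> le_M; rewrite /cells count_flatten -map_comp sumnE big_map.
rewrite (@big_cat_nat _ _ _ (size s)) //= [X in (_ + X)%N]big1_seq ?addn0.
  by rewrite /index_iota subn0; apply: eq_bigr => i _ /=; rewrite count_map.
by move=> i /andP[_]; rewrite mem_index_iota => /andP[h _]; rewrite nth_default.
Qed.

Definition column_height (s : seq nat) (j c : nat) : Prop :=
  forall i, (i < c)%N = (j < nth 0 s i)%N.

Lemma column_height_exists (s : seq nat) (j : nat) :
  is_partition s -> exists c, column_height s j c.
Proof.
move=> ps; have ex : exists c, (nth 0 s c <= j)%N by exists (size s); rewrite nth_default.
case: (ex_minnP ex) => c hc minc; exists c => i.
have [lt|ge] := ltnP i c.
  by apply/esym; rewrite ltnNge; apply/negP => /minc; lia.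
by have := partition_nth_geq ps ge; lia.
Qed.

Lemma hook_lengthE (s : seq nat) (i j c : nat) :
  column_height s j c -> (j < nth 0 s i)%N ->
  hook_length s (i, j) = (nth 0 s i - j + (c - i) - 1)%N.
Proof.
move=> hc lt_j; have lt_i : (i < size s)%N.
  by rewrite ltnNge; apply/negP => h; rewrite nth_default in lt_j.
have -> : hook_length s (i, j) = ((nth 0 s i - j.+1) + (c - i.+1) + 1)%N.
  congr (_ + _ + _)%N.
    rewrite /arm (count_cells _ (leqnn _)) (bigD1_seq i) ?mem_index_iota ?iota_uniq //=.
    rewrite (@eq_count _ _ (leq j.+1)) => [|j']; last by rewrite /= eqxx.
    rewrite count_geq_iota big1 ?addn0 // => i' /negbTE ne.
    by rewrite (@eq_count _ _ pred0) ?count_pred0 // => j'; rewrite /= ne.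
  have le_c : (c <= size s)%N.
    rewrite leqNgt; apply/negP => h; have := hc (size s).
    by rewrite h nth_default.
  rewrite -{1}(minn_idPl le_c) -count_range_iota /leg (count_cells _ (leqnn _)).
  rewrite -[RHS]sum1_count [RHS]big_mkcond /= /index_iota subn0; apply: eq_bigr => i' _.
  case: ifP => /= [/andP[h1 h2]|h].
    rewrite (@eq_count _ _ (pred1 j)) => [|j']; last by rewrite /= h1 andbT.
    rewrite count_uniq_mem ?iota_uniq // mem_iota /= add0n -hc; lia.
  case: (ltnP i i') h => /= h1 h2; last first.
    by rewrite (@eq_count _ _ pred0) ?count_pred0 // => j'; rewrite /= andbF.
  rewrite (@eq_count _ _ (pred1 j)) => [|j']; last by rewrite /= andbT.
  by rewrite count_uniq_mem ?iota_uniq // mem_iota /= add0n -hc h2.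
by have := hc i; lia.
Qed.

(** The first [c] rows have their beads above [j - c], all others below it. Together with
    [column_of_gap], the gaps correspond to the columns. *)
Lemma column_not_bead (s : seq nat) (j c : nat) :
  column_height s j c -> bead s (j%:Z - c%:Z) = false.
Proof.
move=> hc; apply/negP => /beadP[i]; rewrite /bd; have := hc i; lia.
Qed.

Lemma column_of_gap (s : seq nat) (y : int) :
  is_partition s -> ~~ bead s y -> exists j c, column_height s j c /\ y = j%:Z - c%:Z.
Proof.
move=> ps nb; set c := row s y.
have h1 : bd s c < y by rewrite lt_neqAle row_le andbT.
exists (absz (y + c%:Z)), c; have : 0 <= y + c%:Z by move: h1; rewrite /bd; lia.
move=> h0; split; last by lia.
move=> i; have [lt|ge] := ltnP i c.
  have hc : (c.-1 < c)%N by lia.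
  have := lt_row hc; have : (i <= c.-1)%N by lia.
  by move/(partition_nth_geq ps); rewrite /bd; lia.
by have := partition_nth_geq ps ge; move: h1; rewrite /bd; lia.
Qed.

(** The hook length of [(i, j)] is the distance from the gap [j - c] of its column up to the bead of
    row [i]. So a hook of length [k + 1] is a bead with a gap [k + 1] places below it. *)
Lemma coreP (k : nat) (s : seq nat) :
  is_core k.+1 s <->
  is_partition s /\ forall x, bead s x -> bead s (x - k.+1%:Z).
Proof.
split=> [/andP[ps /allP H]|[ps H]].
  split=> // _ /beadP[i ->]; apply/negPn/negP => nb.
  have [j [c [hc E]]] := column_of_gap ps nb.
  have hci := hc i.
  have lt_j : (j < nth 0 s i)%N by move: E hci; rewrite /bd; lia.
  have := H (i, j); rewrite mem_cells /= lt_j => /(_ isT).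
  by rewrite (hook_lengthE hc lt_j); move: E hci; rewrite /bd; lia.
apply/andP; split=> //; apply/allP => -[i j]; rewrite mem_cells /= => lt_j.
have [c hc] := column_height_exists j ps.
rewrite (hook_lengthE hc lt_j); apply/eqP => E.
have := H _ (bead_bd i ps); suff -> : bd s i - k.+1%:Z = j%:Z - c%:Z.
  by rewrite column_not_bead.
by have := hc i; rewrite /bd; lia.
Qed.

Lemma core_partition (k : nat) (s : seq nat) : is_core k s -> is_partition s.
Proof. by case/andP. Qed.

Lemma core_bead_sub (k : nat) (s : seq nat) (x : int) :
  is_core k.+1 s -> bead s x -> bead s (x - k.+1%:Z).
Proof. by case/coreP => _; apply. Qed.

Lemma core_bead_subn (k m : nat) (s : seq nat) (x : int) :
  is_core k.+1 s -> bead s x -> bead s (x - m%:Z * k.+1%:Z).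
Proof.
move=> cs bx; elim: m => [|m IH]; first by rewrite mul0r subr0.
suff -> : x - m.+1%:Z * k.+1%:Z = x - m%:Z * k.+1%:Z - k.+1%:Z.
  exact: core_bead_sub.
by lia.
Qed.

Definition below (k : nat) (s : seq nat) (i : nat) : nat := row s (bd s i - k.+1%:Z).

Lemma bd_below (k : nat) (s : seq nat) (i : nat) :
  is_core k.+1 s -> bd s (below k s i) = bd s i - k.+1%:Z.
Proof.
by move=> cs; apply/eqP/(core_bead_sub cs)/bead_bd/core_partition/cs.
Qed.

(* Row [i] has [s_i - s_(below i)] cells of hook length at most [k]: these are
   the columns whose gap lies above the bead [bd s i - (k + 1)]. *)
Lemma degE (k : nat) (s : seq nat) (M : nat) :
  is_core k.+1 s -> (size s <= M)%N ->
  (deg k s + \sum_(0 <= i < M) below k s i = \sum_(0 <= i < M) (k.+1 + i))%N.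
Proof.
move=> cs le_M; have ps := core_partition cs.
rewrite /deg (count_cells _ le_M) -big_split /=; apply: eq_bigr => i _.
have E := bd_below i cs.
rewrite (@eq_in_count _ _ (leq (nth 0 s (below k s i))%N)).
  rewrite count_geq_iota; have : bd s (below k s i) < bd s i by lia.
  by move=> /(bd_lt_idx ps)/ltnW/(partition_nth_geq ps); move: E; rewrite /bd; lia.
move=> j; rewrite mem_iota /= add0n => lt_j.
have [c hc] := column_height_exists j ps; rewrite (hook_lengthE hc lt_j).
have := hc i; have := hc (below k s i); move: E; rewrite /bd; lia.
Qed.

(** Otherwise row [below k rho i + 1] of [ga] would reach the bead of row [below k rho i] of [rho],
    against interlacing. Every row thus contributes a nonnegative term to [deg ga - deg rho]. *)
Lemma below_le (k : nat) (rho ga : seq nat) (i : nat) :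
  is_core k.+1 rho -> is_core k.+1 ga -> interlace rho ga ->
  (below k ga i <= below k rho i)%N.
Proof.
move=> cr cg H; have pr := core_partition cr; have pg := core_partition cg.
rewrite leqNgt; apply/negP => lt.
have := bd_leq pg lt; have := bd_below i cr; have := bd_below i cg.
by have [_] := H (below k rho i); have [] := H i; lia.
Qed.

Lemma below_eq (k : nat) (rho ga : seq nat) (i : nat) :
  is_core k.+1 rho -> is_core k.+1 ga -> interlace rho ga ->
  bd rho i = bd ga i -> below k rho i = below k ga i.
Proof.
move=> cr cg H E; have pr := core_partition cr; have pg := core_partition cg.
apply/eqP; rewrite eqn_leq (below_le i cr cg H) andbT leqNgt; apply/negP => lt.
have h1 := bd_ltn pr lt; have h2 := bd_below i cr; have h3 := bd_below i cg.
by have [] := H (below k ga i); lia.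
Qed.

Lemma deg_interlace (k : nat) (rho ga : seq nat) (M : nat) :
  is_core k.+1 rho -> is_core k.+1 ga -> interlace rho ga ->
  (size rho <= M)%N -> (size ga <= M)%N ->
  (deg k ga = deg k rho + \sum_(0 <= i < M) (below k rho i - below k ga i))%N.
Proof.
move=> cr cg H hr hg; have := degE cr hr; rewrite -(degE cg hg).
have -> : (\sum_(0 <= i < M) below k rho i =
  \sum_(0 <= i < M) (below k rho i - below k ga i) + \sum_(0 <= i < M) below k ga i)%N.
  by rewrite -big_split; apply: eq_bigr => i _ /=; rewrite subnK // below_le.
by rewrite addnA => /addIn ->.
Qed.

(** * Rotation of blocks of runners *)

Definition res (k : nat) (x : int) : 'I_k.+1 := inord (absz (x %% k.+1%:Z)%Z).

Lemma res_modz (k : nat) (x y : int) :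
  res k x = res k y <-> ((x %% k.+1%:Z)%Z = (y %% k.+1%:Z)%Z).
Proof.
split=> [E|E]; last by rewrite /res E.
have nz : k.+1%:Z != 0 by lia.
have hx := modz_ge0 x nz; have hy := modz_ge0 y nz.
have pz : 0 < k.+1%:Z by lia.
have ux := ltz_pmod x pz; have uy := ltz_pmod y pz.
by have := congr1 val E; rewrite /= !inordK; lia.
Qed.

Lemma res_eqP (k : nat) (x y : int) :
  res k x = res k y <-> exists c, x = y + c * k.+1%:Z.
Proof.
split=> [/res_modz E|[c ->]]; last first.
  by apply/res_modz; rewrite addrC modzMDl.
move/eqP: E; rewrite eqz_mod_dvd => /dvdzP[c E]; exists c.
by rewrite -E addrC subrK.
Qed.

Lemma res_shift (k : nat) (x c : int) : res k (x + c * k.+1%:Z) = res k x.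
Proof. by apply/res_eqP; exists c. Qed.

Lemma res_add (k : nat) (x : int) : res k (x + k.+1%:Z) = res k x.
Proof. by rewrite -[X in _ + X]mul1r res_shift. Qed.

Lemma res_sub (k : nat) (x : int) : res k (x - k.+1%:Z) = res k x.
Proof. by rewrite -[in RHS](subrK k.+1%:Z x) res_add. Qed.

Lemma mul_small (c m : int) : - m < c * m -> c * m < m -> c = 0.
Proof. by move=> h1 h2; nia. Qed.

Lemma res_inj_near (k : nat) (x y : int) :
  x <= y < x + k.+1%:Z -> res k x = res k y -> x = y.
Proof.
move=> h /res_eqP[c E]; have : c = 0; last by move=> c0; subst c; lia.
by apply: (@mul_small _ k.+1%:Z); lia.
Qed.

Lemma res_ord (k : nat) (a : 'I_k.+1) : res k a%:Z = a.
Proof.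
rewrite /res modz_small; last by have := ltn_ord a; lia.
by rewrite /= inord_val.
Qed.

(* [A] is the set of residues at which the cyclic blocks end: [e] is the first
   position of the block of [x], [d] is the last one. *)
Definition start (k : nat) (A : {set 'I_k.+1}) (e x : int) : Prop :=
  [/\ e <= x, res k (e - 1) \in A & forall y : int, e <= y < x -> res k y \notin A].

Definition stop (k : nat) (A : {set 'I_k.+1}) (x d : int) : Prop :=
  [/\ x <= d, res k d \in A & forall y : int, x <= y < d -> res k y \notin A].

Definition next_end (k : nat) (A : {set 'I_k.+1}) (x : int) : int :=
  x + (find (fun m : nat => res k (x + m%:Z) \in A) (iota 0 k.+1))%:Z.

Lemma next_end_stop (k : nat) (A : {set 'I_k.+1}) (a : 'I_k.+1) (x : int) :
  a \in A -> stop A x (next_end A x).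
Proof.
move=> aA; set P := fun m : nat => res k (x + m%:Z) \in A.
have hasP : has P (iota 0 k.+1).
  have pz : 0 < k.+1%:Z by lia.
  have nz : k.+1%:Z != 0 by lia.
  have h0 := modz_ge0 (a%:Z - x) nz; have h1 := ltz_pmod (a%:Z - x) pz.
  (* The distance from [x] up to the next position of residue [a]. *)
  apply/hasP; exists (absz ((a%:Z - x) %% k.+1%:Z)%Z).
    by rewrite mem_iota; lia.
  rewrite /P; suff -> : res k (x + (absz ((a%:Z - x) %% k.+1%:Z)%Z)%:Z) = a by [].
  rewrite -[RHS]res_ord; apply/res_eqP; exists (- ((a%:Z - x) %/ k.+1%:Z)%Z).
  by have := divz_eq (a%:Z - x) k.+1%:Z; lia.
have lt_f := hasP; rewrite has_find size_iota in lt_f.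
have := nth_find 0%N hasP; rewrite nth_iota // add0n => hf.
split; [rewrite /next_end; lia | exact: hf |].
move=> y /andP[h1 h2]; have lt_y : (absz (y - x)%R < find P (iota 0 k.+1))%N.
  by move: h2; rewrite /next_end -/P; lia.
have := before_find 0%N lt_y; rewrite nth_iota; last by lia.
rewrite add0n /P; have -> : x + (absz (y - x)%R)%:Z = y by lia.
by move=> ->.
Qed.

Lemma start_shift (k : nat) (A : {set 'I_k.+1}) (e x c : int) :
  start A e x -> start A (e + c * k.+1%:Z) (x + c * k.+1%:Z).
Proof.
case=> h1 h2 h3; split; first lia.
  suff -> : e + c * k.+1%:Z - 1 = e - 1 + c * k.+1%:Z by rewrite res_shift.
  by lia.
move=> y h; rewrite -(res_shift _ y (- c)); apply: h3; lia.
Qed.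

Lemma start_add (k : nat) (A : {set 'I_k.+1}) (e x : int) :
  start A e x -> start A (e + k.+1%:Z) (x + k.+1%:Z).
Proof. by move/(start_shift 1); rewrite mul1r. Qed.

Lemma start_sub (k : nat) (A : {set 'I_k.+1}) (e x : int) :
  start A e x -> start A (e - k.+1%:Z) (x - k.+1%:Z).
Proof. by move/(start_shift (-1)); rewrite mulN1r. Qed.

Lemma start_exists (k : nat) (A : {set 'I_k.+1}) (a : 'I_k.+1) (x : int) :
  a \in A -> exists e, start A e x.
Proof.
move=> aA.
have ex : exists m : nat, res k (x - m%:Z - 1) \in A.
  have [h1 h2 _] := next_end_stop (x - 1) aA; pose q := next_end A (x - 1) - x + 1.
  (* Moving the end [x - 1 + q] down by [q] periods gives [x - 1 - q k], an end at or below
     [x - 1]. *)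
  exists (absz (q * k%:Z)%R).
  have -> : (absz (q * k%:Z)%R)%:Z = q * k%:Z by rewrite /q; nia.
  suff -> : x - q * k%:Z - 1 = next_end A (x - 1) + (- q) * k.+1%:Z by rewrite res_shift.
  by rewrite /q; lia.
case: (ex_minnP ex) => m hm minm; exists (x - m%:Z); split=> //; first lia.
move=> y h; apply/negP => hy; have := minm (absz (x - y - 1)%R).
have -> : x - (absz (x - y - 1)%R)%:Z - 1 = y by lia.
by move=> /(_ hy); lia.
Qed.

Lemma start_lt (k : nat) (A : {set 'I_k.+1}) (e x : int) :
  start A e x -> x < e + k.+1%:Z.
Proof.
case=> h1 h2 h3; rewrite ltNge; apply/negP => h.
have := h3 (e - 1 + k.+1%:Z); rewrite res_add h2 => hh.
have : e <= e - 1 + k.+1%:Z < x by lia.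
by move/hh.
Qed.

Lemma start_uniq (k : nat) (A : {set 'I_k.+1}) (e e' x : int) :
  start A e x -> start A e' x -> e = e'.
Proof.
have aux a b : start A a x -> start A b x -> a <= b.
  case=> [ha ha' _] [_ _ hb]; rewrite leNgt; apply/negP => lt.
  by have := hb (a - 1); rewrite ha' => /(_ ltac:(lia)).
by move=> h h'; apply: le_anti; rewrite !aux.
Qed.

Lemma start_sub_range (k : nat) (A : {set 'I_k.+1}) (e x y : int) :
  start A e x -> e <= y <= x -> start A e y.
Proof. by case=> h1 h2 h3 h; split=> // [|z hz]; [lia | apply: h3; lia]. Qed.

Lemma start_here (k : nat) (A : {set 'I_k.+1}) (x : int) :
  res k (x - 1) \in A -> start A x x.
Proof. by split=> // y; lia. Qed.

Lemma start_next (k : nat) (A : {set 'I_k.+1}) (e x : int) :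
  start A e x -> res k x \notin A -> start A e (x + 1).
Proof.
case=> h1 h2 h3 nA; split=> //; first lia.
by move=> y h; case: (eqVneq y x) => [->//|ne]; apply: h3; lia.
Qed.

(** By [start_lt] the bead [t] comes before [e + k + 1], so the runner of the block start reaches
    into a later period than any other runner of the block. *)
Definition block_dominant (k : nat) (A : {set 'I_k.+1}) (la : seq nat) : Prop :=
  forall e t, start A e t -> e < t -> bead la t -> bead la (e + k.+1%:Z).

(* The bead set of [nu] arises from that of [la] by rotating every block: the
   runner at the start of a block moves to its end, the others move down by
   one. *)
Definition block_shift (k : nat) (A : {set 'I_k.+1}) (la nu : seq nat) : Prop :=
  [/\ block_dominant A la,
      forall x, res k x \notin A -> bead nu x = bead la (x + 1) &
      forall e x, res k x \in A -> start A e x -> bead nu x = bead la e].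

Lemma block_shift_core (k : nat) (A : {set 'I_k.+1}) (a : 'I_k.+1) (la nu : seq nat) :
  a \in A -> is_core k.+1 la -> is_partition nu -> block_shift A la nu -> is_core k.+1 nu.
Proof.
move=> aA cl pn [_ H1 H2]; apply/coreP; split=> // x.
have [xA|xA] := boolP (res k x \in A).
  have [e he] := start_exists x aA.
  rewrite (H2 _ _ xA he) (H2 (e - k.+1%:Z)) ?res_sub //; last exact: start_sub.
  exact: core_bead_sub.
rewrite (H1 _ xA) H1 ?res_sub // => h.
suff -> : x - k.+1%:Z + 1 = x + 1 - k.+1%:Z by exact: core_bead_sub.
lia.
Qed.

Lemma block_shift_uniq (k : nat) (A : {set 'I_k.+1}) (a : 'I_k.+1) (la nu nu' : seq nat) :
  a \in A -> is_partition nu -> is_partition nu' ->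
  block_shift A la nu -> block_shift A la nu' -> nu = nu'.
Proof.
move=> aA pn pn' [_ H1 H2] [_ H1' H2']; apply: bead_eq => // x.
have [xA|xA] := boolP (res k x \in A); last by rewrite H1 // H1'.
by have [e he] := start_exists x aA; rewrite (H2 e) // (H2' e).
Qed.

(** The rotation row by row: a bead of [la] moves up to the end of its block, unless the old
    position of the preceding bead comes first; then it stops just below that position. *)
Definition shift_row (k : nat) (A : {set 'I_k.+1}) (la : seq nat) (i : nat) : int :=
  if i is j.+1 then Num.min (next_end A (bd la i)) (bd la j - 1)
  else next_end A (bd la 0).

Lemma block_shift_exists (k : nat) (A : {set 'I_k.+1}) (a : 'I_k.+1) (la : seq nat) :
  a \in A -> is_core k.+1 la -> block_dominant A la ->
  exists nu, [/\ is_partition nu, block_shift A la nu &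
                 forall i, bd nu i = shift_row A la i].
Proof.
move=> aA cl dom; have pl := core_partition cl.
have stA x := next_end_stop x aA.
have rowS j : shift_row A la j.+1 <= next_end A (bd la j.+1) /\ shift_row A la j.+1 < bd la j.
  by rewrite /=; lia.
have row_ge i : bd la i <= shift_row A la i.
  case: i => [|j]; first by case: (stA (bd la 0)).
  by have := bd_ltn pl (ltnSn j); case: (stA (bd la j.+1)) => /=; lia.
have [nu pn En] : exists2 nu, is_partition nu & forall i, bd nu i = shift_row A la i.
  pose b i := absz (shift_row A la i + i%:Z + 1).
  have bE i : (b i)%:Z = shift_row A la i + i%:Z + 1.
    by have := row_ge i; rewrite /b /bd; lia.
  (* Row [size la] may become nonempty; the next row stays below the bead of row [size la] of [la]
     and is therefore empty. *)
  have [i||nu pn Hnu] := @partition_exists b (size la).+1.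
  - by have := bE i; have := bE i.+1; have := row_ge i; have := rowS i; lia.
  - have := bE (size la).+1; have := rowS (size la); have := row_ge (size la).+1.
    by rewrite !bd_default //; lia.
  by exists nu => // i; rewrite /bd Hnu bE; lia.
exists nu; split=> //.
have beadE x i : shift_row A la i = x -> bead nu x by rewrite -En => <-; exact: bead_bd.
split=> // [x xA|e x xA he].
  apply/idP/idP => [/beadP[i]|].
    rewrite En; case: i => [|j] /= Ex.
      by case: (stA (bd la 0)) => _; rewrite -Ex (negbTE xA).
    case: (stA (bd la j.+1)) => _ hA _.
    have -> : x + 1 = bd la j; last exact: bead_bd.
    by move: Ex; case: leP => _ Ex; [rewrite -Ex (negbTE xA) in hA | lia].
  (* The bead [x + 1] is not the first position of its block, so by dominance and the core property
     the block start [e] carries a bead too. Hence row [j + 1] lies in the block at or above [e],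
     and row [j] stops it at [x]. *)
  move=> /beadP[j Ej]; apply: (beadE _ j.+1) => /=.
  have [e he] := start_exists x aA.
  have he1 := start_next he xA; have [le_e _ hno] := he1.
  have be : bead la e.
    have := core_bead_sub cl (dom _ _ he1 _ _); rewrite addrK; apply; last first.
      by rewrite Ej; exact: bead_bd.
    by case: he; lia.
  have [i Ei] := beadP be.
  have lt_ji : (j < i)%N by apply: (bd_lt_idx pl); rewrite -Ej -Ei; case: he; lia.
  have hj1 := bd_leq pl lt_ji; have hj2 := bd_ltn pl (ltnSn j).
  case: (stA (bd la j.+1)) => h1 h2 _.
  suff : x < next_end A (bd la j.+1) by lia.
  rewrite ltNge; apply/negP => h3.
  by have := hno (next_end A (bd la j.+1)); rewrite h2 => /(_ ltac:(lia)).
apply/idP/idP => [/beadP[i]|be].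
  rewrite En => Ex.
  (* A bead stopped early rests before the end of its block, at a residue outside [A]. *)
  have Ex' : x = next_end A (bd la i).
    case: i Ex => [|j] //= Ex; case: (stA (bd la j.+1)) => h1 h2 h3.
    have hd := bd_ltn pl (ltnSn j).
    apply/eqP; rewrite eq_le; apply/andP; split; first by lia.
    rewrite leNgt; apply/negP => lt; have := h3 x; rewrite xA => h.
    by have := h ltac:(lia).
  case: (stA (bd la i)) => h1 h2 h3; have [e1 e2 e3] := he.
  have le_e : e <= bd la i.
    rewrite leNgt; apply/negP => lt; have := h3 (e - 1); rewrite e2 => h.
    by have := h ltac:(lia).
  have [->|ne] := eqVneq e (bd la i); first exact: bead_bd.
  have hs : start A e (bd la i) by apply: start_sub_range he _; lia.
  have := dom _ _ hs ltac:(lia) (bead_bd i pl).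
  by move/(core_bead_sub cl); rewrite addrK.
have [i Ei] := beadP be; have [e1 e2 e3] := he.
(* The highest bead at or below [x] lies in the block of [x]. It moves to [x] because the preceding
   bead is above [x]. *)
have le_r : e <= bd la (row la x).
  rewrite leNgt; apply/negP => lt; have := row_le la x.
  rewrite Ei in lt; have /lt_row := bd_lt_idx pl lt.
  by lia.
have hr := row_le la x.
have Enx : next_end A (bd la (row la x)) = x.
  case: (stA (bd la (row la x))) => h1 h2 h3.
  apply/eqP; rewrite eq_le; apply/andP; split; rewrite leNgt; apply/negP => lt.
    by have := h3 x; rewrite xA => /(_ ltac:(lia)).
  by have := e3 (next_end A (bd la (row la x))); rewrite h2 => /(_ ltac:(lia)).
apply: (beadE _ (row la x)).
case Er: (row la x) Enx => [|j] //= Enx.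
have : (j < row la x)%N by rewrite Er.
by move=> /lt_row; lia.
Qed.

Lemma block_shift_rows (k : nat) (A : {set 'I_k.+1}) (a : 'I_k.+1) (la nu : seq nat) (i : nat) :
  a \in A -> is_core k.+1 la -> is_partition nu -> block_shift A la nu ->
  bd nu i = shift_row A la i.
Proof.
move=> aA cl pn H; have [dom _ _] := H.
have [nu' [pn' H' R]] := block_shift_exists aA cl dom.
by rewrite (block_shift_uniq aA pn pn' H H').
Qed.

Lemma block_shift_interlace (k : nat) (A : {set 'I_k.+1}) (a : 'I_k.+1) (la nu : seq nat) :
  a \in A -> is_core k.+1 la -> is_partition nu -> block_shift A la nu ->
  interlace la nu.
Proof.
move=> aA cl pn H i; have pl := core_partition cl.
rewrite !(block_shift_rows _ aA cl pn H); split; last by rewrite /=; lia.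
case: (next_end_stop (bd la i) aA) => h _ _.
by case: i h => [|j] h //=; have := bd_ltn pl (ltnSn j); lia.
Qed.

Lemma stop_le (k : nat) (A A' : {set 'I_k.+1}) (x d d' : int) :
  A' \subset A -> stop A x d -> stop A' x d' -> d <= d'.
Proof.
move=> /subsetP sub [h1 h2 h3] [h1' h2' _]; rewrite leNgt; apply/negP => lt.
by have := h3 d'; rewrite (sub _ h2') => /(_ ltac:(lia)).
Qed.

(** With fewer ends, [shift_row] lets every bead travel at least as far. *)
Lemma block_shift_mono (k : nat) (A A' : {set 'I_k.+1}) (a : 'I_k.+1) (la nu nu' : seq nat) :
  a \in A' -> A' \subset A -> is_core k.+1 la -> is_partition nu -> is_partition nu' ->
  block_shift A la nu -> block_shift A' la nu' -> forall i, bd nu i <= bd nu' i.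
Proof.
move=> aA' sub cl pn pn' H H' i; have aA := subsetP sub _ aA'.
rewrite (block_shift_rows _ aA cl pn H) (block_shift_rows _ aA' cl pn' H').
have := stop_le sub (next_end_stop (bd la i) aA) (next_end_stop (bd la i) aA').
by case: i => [|i] //=; lia.
Qed.

(** If the top bead were inside a block, dominance would yield a bead one period above the block
    start, beyond the top. *)
Lemma top_start (k : nat) (A : {set 'I_k.+1}) (a : 'I_k.+1) (la : seq nat) :
  a \in A -> is_core k.+1 la -> block_dominant A la -> res k (bd la 0 - 1) \in A.
Proof.
move=> aA cl dom; have pl := core_partition cl.
have [e he] := start_exists (bd la 0) aA.
have [h1 h2 _] := he; case: (eqVneq e (bd la 0)) => [<-//|ne].
have := dom _ _ he ltac:(lia) (bead_bd 0 pl).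
by move/(bead_le_top pl); have := start_lt he; lia.
Qed.

Lemma block_shift_top (k : nat) (A : {set 'I_k.+1}) (a : 'I_k.+1) (la nu : seq nat) :
  a \in A -> is_core k.+1 la -> is_partition nu -> block_shift A la nu ->
  start A (bd la 0) (bd nu 0) /\ res k (bd nu 0) \in A.
Proof.
move=> aA cl pn H; have [dom _ _] := H.
rewrite (block_shift_rows 0 aA cl pn H) /=.
case: (next_end_stop (bd la 0) aA) => h1 h2 h3; split=> //; split=> //.
exact: top_start aA cl dom.
Qed.

(** * Strong covers *)

(* Boolean hypotheses slow down [lia] and [nia] considerably, and those about
   beads and membership are irrelevant to an arithmetic goal. *)
Ltac clear_bool :=
  repeat match goal with
  | H : context [@in_mem] |- _ => clear H
  | H : context [bead] |- _ => clear H
  | H : context [is_partition] |- _ => clear H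
  | H : context [is_core] |- _ => clear H
  end.
Ltac lia_pos := clear_bool; lia.
Ltac nia_pos := clear_bool; nia.

Lemma sum_nat_eq1_unique (f : nat -> nat) (M : nat) :
  (\sum_(0 <= i < M) f i = 1)%N ->
  exists2 i0, (i0 < M /\ f i0 = 1)%N & forall i, (i < M)%N -> i != i0 -> f i = 0%N.
Proof.
rewrite big_mkord => /eqP/sum_nat_eq1[/= i0 [_ f1 f0]].
exists (val i0); first by split; [exact: ltn_ord | exact: f1].
by move=> i lt_i ne; apply: (f0 (Ordinal lt_i)) => //; rewrite -val_eqE.
Qed.

Lemma sum_nat_indicator (f : nat -> nat) (M i0 : nat) :
  (i0 < M)%N -> f i0 = 1%N -> (forall i, i != i0 -> f i = 0%N) ->
  (\sum_(0 <= i < M) f i = 1)%N.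
Proof.
move=> lt_i f1 f0; rewrite (bigD1_seq i0) ?mem_index_iota ?iota_uniq //= f1.
by rewrite big1 // => i /f0.
Qed.

Lemma bead_low (s : seq nat) (x : int) : is_partition s -> x < - (size s)%:Z -> bead s x.
Proof.
move=> ps h; have -> : x = bd s (absz (x + 1)%R) by rewrite bd_default; lia_pos.
exact: bead_bd.
Qed.

Lemma core_bead_le (k : nat) (s : seq nat) (x y : int) :
  is_core k.+1 s -> res k y = res k x -> y <= x -> bead s x -> bead s y.
Proof.
move=> cs /res_eqP[c ->] le bx.
suff -> : x + c * k.+1%:Z = x - (absz c)%:Z * k.+1%:Z by exact: core_bead_subn.
have : c <= 0 by nia_pos.
by move=> hc; congr (_ + _); rewrite -mulNr; congr (_ * _); lia_pos.
Qed.

(* The beads of [ga] are those of [rho] with the runners of [p] and [q]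
   exchanged, and every runner strictly between them is lower than that of
   [q]. *)
Definition runner_swap (k : nat) (p q : int) (rho ga : seq nat) : Prop :=
  [/\ forall x, res k x = res k p -> bead rho x = bead ga (x + (q - p)),
      forall x, res k x = res k q -> bead rho x = bead ga (x - (q - p)),
      forall x, res k x <> res k p -> res k x <> res k q -> bead rho x = bead ga x &
      forall c t : int, p < t < q ->
        bead rho (t + c * k.+1%:Z) -> bead rho (q + (c + 1) * k.+1%:Z)].

Lemma interlace_not_bead (rho ga : seq nat) (i : nat) :
  is_partition rho -> is_partition ga -> interlace rho ga -> bd rho i < bd ga i ->
  bead ga (bd rho i) = false /\ bead rho (bd ga i) = false.
Proof.
move=> pr pg H lt; split; first by apply: bead_between pg _ lt; case: (H i).
apply/negP => /beadP[j Ej]; rewrite Ej in lt.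
have := bd_lt_idx pr lt; case: i Ej lt => // i Ej lt lt_ji.
by have := bd_leq pr (lt_ji : (j <= i)%N); have [_] := H i; lia_pos.
Qed.

(** By [deg_interlace] a single row [i0] changes its [below] index, and by one. Every other moved
    row passes its displacement on to the row one period lower. So the moved beads form one run
    along a runner, from row 0 down to row [i0]. *)
Lemma strong_cover_swap (k : nat) (rho ga : seq nat) :
  is_core k.+1 rho -> is_core k.+1 ga -> interlace rho ga ->
  deg k ga = (deg k rho + 1)%N ->
  bd rho 0 < bd ga 0 < bd rho 0 + k.+1%:Z ->
  runner_swap k (bd rho 0) (bd ga 0) rho ga.
Proof.
move=> cr cg H Edeg /andP[lt0 lt0N].
have pr := core_partition cr; have pg := core_partition cg.
pose M := maxn (size rho) (size ga).
have hMr : (size rho <= M)%N by rewrite leq_maxl.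
have hMg : (size ga <= M)%N by rewrite leq_maxr.
have := deg_interlace cr cg H hMr hMg; rewrite Edeg => /addnI/esym.
move=> /sum_nat_eq1_unique[i0 [lt_i0 f1] f0].
have same i : i <> i0 -> below k rho i = below k ga i.
  move=> ne; have [lt|ge] := ltnP i M.
    by have := f0 i lt (introN eqP ne); have := below_le i cr cg H; lia_pos.
  by apply: below_eq => //; rewrite !bd_default ?(leq_trans _ ge).
have br i := bd_below (k := k) i cr; have bg i := bd_below (k := k) i cg.
(* Follow the runner downwards until row [i0], by induction on the number of rows below [M]. *)
have moved i : bd rho i < bd ga i -> (i <= i0)%N /\
    exists c : nat, bd rho i = bd rho i0 + c%:Z * k.+1%:Z /\ bd ga i = bd ga i0 + c%:Z * k.+1%:Z.
  have [m] := ubnP (M - i)%N; elim: m i => // m IH i hm lt.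
  have lt_iM : (i < M)%N.
    by rewrite ltnNge; apply/negP => ge; move: lt; rewrite !bd_default ?(leq_trans _ ge) //; lia_pos.
  case: (eqVneq i i0) => [->|/eqP ne]; first by split=> //; exists 0%N; lia_pos.
  have E := same _ ne; have h1 := br i; have h2 := bg i; rewrite E in h1.
  have lt_ij : (i < below k ga i)%N by apply: (bd_lt_idx pg); lia_pos.
  have [] := IH (below k ga i); [lia_pos | lia_pos |] => hle [c [e1 e2]].
  by split; [lia_pos | exists c.+1; lia_pos].
have [_ [c0 [e1 e2]]] := moved _ lt0.
set p := bd rho 0 in lt0 lt0N e1 *; set q := bd ga 0 in lt0 lt0N e2 *.
(* One period below the end of the run, the runners of [q] and [p] occupy the adjacent unmoved rows
   [j] and [j + 1], with no bead between them. *)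
set j := below k ga i0; have Ej : below k rho i0 = j.+1 by rewrite /j; lia_pos.
have gj : bd ga j = q - (c0.+1)%:Z * k.+1%:Z by have := bg i0; rewrite -/j; lia_pos.
have vj1 : bd rho j.+1 = p - (c0.+1)%:Z * k.+1%:Z by have := br i0; rewrite Ej; lia_pos.
have lt_j : (i0 < j)%N by apply: (bd_lt_idx pg); have := bg i0; rewrite -/j; lia_pos.
have unm i : (i0 < i)%N -> bd rho i = bd ga i.
  by move=> lt; have [h _] := H i; case: (ltP (bd rho i) (bd ga i)) => [/moved[]|]; lia_pos.
have vj := unm _ lt_j; have gj1 := unm _ (leqW lt_j).
have [nby nbz] : bead ga (bd rho i0) = false /\ bead rho (bd ga i0) = false.
  by apply: interlace_not_bead => //; lia_pos.
have Ey : bd rho i0 = p - c0%:Z * k.+1%:Z by lia_pos.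
have Ez : bd ga i0 = q - c0%:Z * k.+1%:Z by lia_pos.
have rhoz : bead rho (q - (c0.+1)%:Z * k.+1%:Z) by rewrite -gj -vj; exact: bead_bd.
have gay : bead ga (p - (c0.+1)%:Z * k.+1%:Z) by rewrite -vj1 gj1; exact: bead_bd.
have ptop x : bead rho x -> x <= p by exact: bead_le_top.
have qtop x : bead ga x -> x <= q by exact: bead_le_top.
have rowm (m : nat) : (m <= c0)%N -> exists i, bd rho i = p - m%:Z * k.+1%:Z /\ bd ga i = q - m%:Z * k.+1%:Z.
  elim: m => [_|m IH lt]; first by exists 0%N; rewrite /p /q; lia_pos.
  have [i [h1 h2]] := IH (ltnW lt).
  have ne : i <> i0 by move=> E; subst i; nia_pos.
  by exists (below k ga i); have := br i; have := bg i; rewrite (same _ ne); lia_pos.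
split.
- move=> x /res_eqP[c Ex]; subst x.
  have [le|gt] := leP c 0.
    rewrite (core_bead_le cr (res_shift _ _ _) _ (bead_bd 0 pr)) -/p; last by nia_pos.
    have -> : p + c * k.+1%:Z + (q - p) = q + c * k.+1%:Z by lia_pos.
    by rewrite (core_bead_le cg (res_shift _ _ _) _ (bead_bd 0 pg)) -/q; last by nia_pos.
  apply/idP/idP => [/ptop|/qtop]; nia_pos.
- move=> x /res_eqP[c Ex]; subst x.
  have -> : q + c * k.+1%:Z - (q - p) = p + c * k.+1%:Z by lia_pos.
  have [le|gt] := leP c (- (c0.+1)%:Z).
    rewrite (core_bead_le cr _ _ rhoz) ?(core_bead_le cg _ _ gay) -?mulNr ?res_shift //; nia_pos.
  apply/idP/idP => h; exfalso.
    move: nbz; rewrite (core_bead_le cr _ _ h) // Ez -?mulNr ?res_shift //; nia_pos.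
  move: nby; rewrite (core_bead_le cg _ _ h) // Ey -?mulNr ?res_shift //; nia_pos.
- move=> x np nq; apply/idP/idP => /beadP[i Ex]; subst x.
    have [h _] := H i; case: (ltP (bd rho i) (bd ga i)) => [/moved[_ [c [h1 _]]]|h'].
      by case: np; apply/res_eqP; exists (c%:Z - c0%:Z); lia_pos.
    suff -> : bd rho i = bd ga i by exact: bead_bd.
    by lia_pos.
  have [h _] := H i; case: (ltP (bd rho i) (bd ga i)) => [/moved[_ [c [_ h2]]]|h'].
    by case: nq; apply/res_eqP; exists (c%:Z - c0%:Z); lia_pos.
  suff -> : bd ga i = bd rho i by exact: bead_bd.
  by lia_pos.
(* In [rho] the runner of [q] ends at period [-(c0 + 1)]. Lower periods satisfy the claim. At this
   period rows [j] and [j + 1] leave no room for [t], and from [-c0] to 0 a bead at [t] would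
   contradict interlacing. *)
move=> c t ht hb.
have c_le0 : c <= 0 by rewrite leNgt; apply/negP => gt; have := ptop _ hb; nia_pos.
have [lt|ge] := ltP c (- (c0.+1)%:Z).
  by apply: (core_bead_le cr _ _ rhoz); rewrite -?mulNr ?res_shift //; nia_pos.
exfalso; have [Ec|ne] := eqVneq c (- (c0.+1)%:Z).
  by move: hb; rewrite (@bead_between _ j) //; subst c; lia_pos.
have [i [h1 h2]] := rowm (absz c) ltac:(lia_pos).
have Ec : c = - (absz c)%:Z by lia_pos.
move: hb; rewrite Ec => /beadP[a Ea].
have lt_a : (a < i)%N by apply: (bd_lt_idx pr); lia_pos.
case: i lt_a h1 h2 => // i lt_a h1 h2.
by have := bd_leq pr (lt_a : (a <= i)%N); have [_] := H i; lia_pos.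
Qed.

(** With [m0 + 1] the number of periods by which the runner of [q] in [rho] falls short of [q], the
    moved rows are those going from [p] to [q] lowered by [0, ..., m0] periods. Only the last of
    them changes its [below] index. *)
Lemma swap_strong_cover (k : nat) (rho ga : seq nat) :
  is_core k.+1 rho -> is_core k.+1 ga -> interlace rho ga ->
  bd rho 0 < bd ga 0 < bd rho 0 + k.+1%:Z ->
  runner_swap k (bd rho 0) (bd ga 0) rho ga ->
  deg k ga = (deg k rho + 1)%N.
Proof.
move=> cr cg H /andP[lt0 lt0N] [_ S2 S3 S4].
have pr := core_partition cr; have pg := core_partition cg.
have br i := bd_below (k := k) i cr; have bg i := bd_below (k := k) i cg.
set p := bd rho 0 in lt0 lt0N S2 S3 S4 *; set q := bd ga 0 in lt0 lt0N S2 S3 S4 *.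
have ptop x : bead rho x -> x <= p by exact: bead_le_top.
have bp (m : nat) : bead rho (p - m%:Z * k.+1%:Z) by apply/(core_bead_subn _ cr)/bead_bd.
have bq (m : nat) : bead ga (q - m%:Z * k.+1%:Z) by apply/(core_bead_subn _ cg)/bead_bd.
have ex : exists m : nat, bead rho (q - (m.+1)%:Z * k.+1%:Z).
  exists (absz q + size rho)%N; apply: bead_low => //; nia_pos.
case: (ex_minnP ex) => m0 hm0 minm.
have nbq (m : nat) : (m <= m0)%N -> bead rho (q - m%:Z * k.+1%:Z) = false.
  case: m => [|m] lt; first by apply/negP => /ptop; lia_pos.
  by apply/negP => /minm; lia_pos.
(* By the last clause of [runner_swap], such a bead forces one on the runner of [q] at period
   [-(m - 1)], where there is none. *)
have nbt (m : nat) t : (m <= m0.+1)%N -> p < t < q -> bead rho (t - m%:Z * k.+1%:Z) = false.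
  move=> le ht; apply/negP; rewrite -mulNr => /(S4 _ _ ht).
  case: m le => [|m] le; first by move/ptop; lia_pos.
  suff -> : q + (- m.+1%:Z + 1) * k.+1%:Z = q - m%:Z * k.+1%:Z by rewrite nbq.
  by lia_pos.
have rowm (m : nat) : (m <= m0)%N -> exists i, bd rho i = p - m%:Z * k.+1%:Z /\ bd ga i = q - m%:Z * k.+1%:Z.
  move=> le; have [i Ei] := beadP (bq m); exists i; split=> //.
  have [j Ej] := beadP (bp m); have [hi _] := H i.
  have le_ij : (i <= j)%N.
    rewrite leqNgt; apply/negP => lt; case: i lt hi Ei => // i lt hi Ei.
    by have := bd_leq pr (lt : (j <= i)%N); have [_] := H i; lia_pos.
  have hj := bd_leq pr le_ij.
  have [//|ne] := eqVneq (bd rho i) (p - m%:Z * k.+1%:Z).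
  have ne' : bd rho i <> q - m%:Z * k.+1%:Z.
    by move=> E; have := bead_bd i pr; rewrite E nbq.
  have := nbt m (bd rho i + m%:Z * k.+1%:Z) (leqW le); rewrite addrK bead_bd //.
  by move=> /(_ ltac:(lia_pos)).
have moved i : bd rho i < bd ga i -> exists m : nat,
    [/\ (m <= m0)%N, bd rho i = p - m%:Z * k.+1%:Z & bd ga i = q - m%:Z * k.+1%:Z].
  move=> lt; have [nb _] := interlace_not_bead pr pg H lt.
  have bi := bead_bd i pr.
  have [/res_eqP[c Ec]|/eqP np] := eqVneq (res k (bd rho i)) (res k p); last first.
    have [Eq|/eqP nq] := eqVneq (res k (bd rho i)) (res k q); last by rewrite S3 // nb in bi.
    move: nb; rewrite (core_bead_le cg Eq _ (bead_bd 0 pg)) // -/q.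
    by have := ptop _ bi; lia_pos.
  have c_le0 : c <= 0 by have := ptop _ bi; nia_pos.
  have Ec' : bd rho i = p - (absz c)%:Z * k.+1%:Z.
    by rewrite Ec -mulNr; congr (_ + _ * _); lia_pos.
  have [le|gt] := leqP (absz c) m0.
    have [i' [h1 h2]] := rowm _ le.
    have Ei : i' = i by apply: (bd_inj pr); lia_pos.
    by subst i'; exists (absz c).
  exfalso; have := S2 (bd rho i + (q - p)); rewrite addrK nb => E.
  suff : bead rho (bd rho i + (q - p)).
    rewrite E // Ec; apply/res_eqP; exists c; lia_pos.
  apply: (core_bead_le cr _ _ hm0); last by nia_pos.
  by apply/res_eqP; exists (c + m0.+1%:Z); rewrite Ec; lia_pos.
have [i0 [h1 h2]] := rowm m0 (leqnn _).
have [ja Eja] : exists j, below k ga i0 = j by exists (below k ga i0).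
have [jr Ejr] : exists j, below k rho i0 = j by exists (below k rho i0).
have ga_j : bd ga ja = q - m0.+1%:Z * k.+1%:Z by have := bg i0; rewrite Eja; lia_pos.
have rho_j : bd rho jr = p - m0.+1%:Z * k.+1%:Z by have := br i0; rewrite Ejr; lia_pos.
have rho_ja : bd rho ja = bd ga ja.
  have [a Ea] := beadP hm0; rewrite -ga_j in Ea; rewrite Ea.
  have [hle hlt] := H a.
  have : (a <= ja)%N by rewrite leqNgt; apply/negP => /(bd_ltn pg); lia_pos.
  have : (ja <= a)%N by rewrite leqNgt; apply/negP => /(bd_leq pg); lia_pos.
  by move=> ? ?; congr bd; lia_pos.
(* [nbt] excludes beads between these two, so row [i0] contributes exactly one to the degree. *)
have Ej : jr = ja.+1.
  have lt : (ja < jr)%N by apply: (bd_lt_idx pr); lia_pos.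
  apply/eqP; rewrite eqn_leq lt andbT leqNgt; apply/negP => lt'.
  have hh1 := bd_ltn pr lt'; have hh2 := bd_ltn pr (ltnSn ja).
  have := nbt m0.+1 (bd rho ja.+1 + m0.+1%:Z * k.+1%:Z) (leqnn _).
  by rewrite addrK bead_bd // => /(_ ltac:(lia_pos)).
pose M := maxn (size rho) (size ga).
have hMr : (size rho <= M)%N by rewrite leq_maxl.
have hMg : (size ga <= M)%N by rewrite leq_maxr.
rewrite (deg_interlace cr cg H hMr hMg) (@sum_nat_indicator _ _ i0) //.
- rewrite ltnNge; apply/negP => ge; have := h2; have := h1.
  by rewrite !bd_default ?(leq_trans _ ge) //; lia_pos.
- by rewrite Ejr Eja Ej subSnn.
move=> i /eqP ne; have [hle _] := H i.
case: (ltP (bd rho i) (bd ga i)) => [/moved[m [hm e1 e2]]|hge]; last first.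
  by rewrite (below_eq cr cg H) ?subnn //; lia_pos.
have lt_m : (m < m0)%N.
  rewrite ltnNge; apply/negP => ge; apply: ne; apply: (bd_inj pr).
  by have -> : bd rho i = bd rho i0 by rewrite e1 h1; congr (_ - _%:Z * _); lia_pos.
have [i' [e1' e2']] := rowm _ lt_m.
have -> : below k rho i = i' by apply: (bd_inj pr); have := br i; lia_pos.
have -> : below k ga i = i' by apply: (bd_inj pg); have := bg i; lia_pos.
by rewrite subnn.
Qed.

(** * The new bottom row and chains of strong covers *)

Lemma bd_add_bottom_row0 (k : nat) (la : seq nat) :
  bd (add_bottom_row k la) 0 = bd la 0 + k%:Z.
Proof. by rewrite /bd /=; lia_pos. Qed.

Lemma bd_add_bottom_rowS (k : nat) (la : seq nat) (i : nat) :
  bd (add_bottom_row k la) i.+1 = bd la i - 1.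
Proof. by rewrite /bd /=; lia_pos. Qed.

Lemma add_bottom_row_partition (k : nat) (la : seq nat) :
  (0 < k)%N -> is_partition la -> is_partition (add_bottom_row k la).
Proof.
move=> k_gt0 /andP[srt n0]; apply/andP; split.
  by case: la srt n0 => //= y l -> _; rewrite leq_addl.
by rewrite inE negb_or n0 andbT; lia_pos.
Qed.

Lemma bead_add_bottom_row (k : nat) (la : seq nat) (x : int) :
  (0 < k)%N -> is_partition la ->
  bead (add_bottom_row k la) x = (x == bd la 0 + k%:Z) || bead la (x + 1).
Proof.
move=> k_gt0 pl; have pg := add_bottom_row_partition k_gt0 pl.
apply/idP/orP => [/beadP[[|i] ->]|[/eqP->|/beadP[i Ei]]].
- by left; rewrite bd_add_bottom_row0.
- by right; rewrite bd_add_bottom_rowS subrK bead_bd.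
- by rewrite -bd_add_bottom_row0 bead_bd.
have -> : x = bd (add_bottom_row k la) i.+1 by rewrite bd_add_bottom_rowS; lia_pos.
exact: bead_bd.
Qed.

(** The only block starts at the runner of the top bead, which makes dominance immediate. On this
    runner, moving down by one and adding the bead [bd la 0 + k] amounts to moving up by [k]. *)
Lemma block_shift_bottom_row (k : nat) (la : seq nat) :
  (0 < k)%N -> is_core k.+1 la ->
  block_shift [set res k (bd la 0 - 1)] la (add_bottom_row k la).
Proof.
move=> k_gt0 cl; have pl := core_partition cl.
have top x : bead la x -> x <= bd la 0 by exact: bead_le_top.
have runner c : bead la (bd la 0 + c * k.+1%:Z) = (c <= 0).
  apply/idP/idP => [/top|le]; first by nia_pos.
  by apply: (core_bead_le cl (res_shift _ _ _) _ (bead_bd 0 pl)); nia_pos.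
have startE e x : start [set res k (bd la 0 - 1)] e x ->
    exists c, e = bd la 0 + c * k.+1%:Z.
  by case=> _; rewrite inE => /eqP/res_eqP[c E] _; exists c; lia_pos.
split.
- move=> e t he lt /top bt; have [c E] := startE _ _ he; have lt' := start_lt he.
  have -> : e + k.+1%:Z = bd la 0 + (c + 1) * k.+1%:Z by lia_pos.
  by rewrite runner; nia_pos.
- move=> x; rewrite inE bead_add_bottom_row // => /eqP ne.
  case: eqP => // E; case: ne; rewrite E -(res_add _ (_ - 1)); congr res; lia_pos.
move=> e x; rewrite inE => /eqP hx he; have [c E] := startE _ _ he.
have lt := start_lt he; have [le _ _] := he.
have Ex : x = e - 1 + k.+1%:Z.
  apply/esym/(@res_inj_near k); last first.
    by rewrite res_add hx E; apply/res_eqP; exists c; lia_pos.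
  suff : e - 1 + k.+1%:Z <= x by lia_pos.
  rewrite leNgt; apply/negP => lt'; move/esym: hx => /res_eqP[c' E'].
  have h1 : e = x + 1 + (c + c') * k.+1%:Z by lia_pos.
  have h2 : -1 < c + c' by nia_pos.
  have h3 : c + c' < 0 by nia_pos.
  by lia_pos.
rewrite bead_add_bottom_row //.
have -> : x + 1 = bd la 0 + (c + 1) * k.+1%:Z by lia_pos.
rewrite E !runner; have -> : (x == bd la 0 + k%:Z) = (c == 0); last by lia_pos.
apply/eqP/eqP => h; last by rewrite Ex E h; lia_pos.
have : c * k.+1%:Z = 0 by lia_pos.
by nia_pos.
Qed.

(** The new end [p] cuts the first block, from [bd la 0] to [q], in two. After the swap, [p] carries
    the runner of [bd la 0] and [q] that of [p + 1], as the rotation demands; the last clause of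
    [runner_swap] is dominance for the second piece. *)
Lemma strong_cover_shift (k : nat) (A : {set 'I_k.+1}) (a : 'I_k.+1) (la rho ga : seq nat) :
  a \in A -> is_core k.+1 la -> is_core k.+1 ga -> is_core k.+1 rho ->
  block_shift A la ga -> bd la 0 <= bd rho 0 -> bd rho 0 < bd ga 0 < bd rho 0 + k.+1%:Z ->
  runner_swap k (bd rho 0) (bd ga 0) rho ga ->
  res k (bd rho 0) \notin A /\ block_shift (res k (bd rho 0) |: A) la rho.
Proof.
move=> aA cl cg cr HA le_lp /andP[lt_pq lt_pqN] [S1 S2 S3 S4].
have [sq qA] := block_shift_top aA cl (core_partition cg) HA.
have [dom H1 H2] := HA.
set l0 := bd la 0 in le_lp sq *; set p := bd rho 0 in le_lp lt_pq lt_pqN S1 S2 S3 S4 *.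
set q := bd ga 0 in lt_pq lt_pqN S1 S2 S3 S4 sq qA *.
have [_ l0A noA] := sq; have lt_q := start_lt sq.
have noAc x c : l0 <= x < q -> res k (x + c * k.+1%:Z) \notin A by move/noA; rewrite res_shift.
have qAc c : res k (q + c * k.+1%:Z) \in A by rewrite res_shift.
have pA : res k p \notin A by apply: noA; lia_pos.
have far x c : l0 <= x < l0 + k.+1%:Z -> x <> p -> res k (x + c * k.+1%:Z) <> res k p.
  move=> hx ne; rewrite res_shift => E; apply: ne.
  have [le|lt] := leP x p; first by apply: (res_inj_near _ E); lia_pos.
  by apply/esym; apply: (res_inj_near _ (esym E)); lia_pos.
split=> //; set B := res k p |: A.
have AB x : res k x \notin B -> res k x \notin A by rewrite !inE negb_or => /andP[].
(* A block of [B] starts as in [A] or is a translate of the piece after [p]. *)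
have startB e x : start B e x -> start A e x \/
    exists c t, [/\ e = p + 1 + c * k.+1%:Z, x = t + c * k.+1%:Z & p < t <= q].
  case=> h1 h2 h3; move: h2; rewrite !inE => /orP[/eqP/res_eqP[c Ec]|h2].
    right; exists c, (x - c * k.+1%:Z); split; [lia_pos | lia_pos |].
    suff : x <= q + c * k.+1%:Z by lia_pos.
    rewrite leNgt; apply/negP => lt; have := h3 (q + c * k.+1%:Z).
    by rewrite !inE qAc orbT => /(_ ltac:(lia_pos)).
  by left; split=> // y hy; apply/AB/h3.
split.
- move=> e t /startB[he lt|[c [t' [-> -> ht]]] lt] bt; first exact: dom he lt bt.
  have := S4 c (t' - 1) ltac:(lia_pos).
  rewrite S3; first last.
  + move=> E; have := noAc (t' - 1) c ltac:(lia_pos); by rewrite E qA.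
  + by apply: far; lia_pos.
  rewrite H1; last by apply: noAc; lia_pos.
  have -> : t' - 1 + c * k.+1%:Z + 1 = t' + c * k.+1%:Z by lia_pos.
  move=> /(_ bt); rewrite S2 ?res_shift // => h.
  have -> : p + 1 + c * k.+1%:Z + k.+1%:Z = p + (c + 1) * k.+1%:Z + 1 by lia_pos.
  rewrite -H1; last by rewrite res_shift.
  by suff <- : q + (c + 1) * k.+1%:Z - (q - p) = p + (c + 1) * k.+1%:Z by []; lia_pos.
- move=> x xB; have xA := AB _ xB.
  rewrite S3 ?H1 //; first by move=> E; move: xB; rewrite E !inE eqxx.
  by move=> E; move: xA; rewrite E qA.
move=> e x; rewrite !inE; case: (eqVneq (res k x) (res k p)) => [/= Ex _ he|/eqP ne /= xA he].
  have [c Ec] := (res_eqP k x p).1 Ex.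
  have sB : start B (l0 + c * k.+1%:Z) x.
    rewrite Ec; apply: start_shift; split=> //; first by rewrite !inE l0A orbT.
    move=> y hy; rewrite !inE negb_or; apply/andP; split; last by apply: noA; lia_pos.
    by apply/eqP; rewrite -(res_shift k y 0); apply: far; lia_pos.
  rewrite (start_uniq he sB) S1 //.
  have -> : x + (q - p) = q + c * k.+1%:Z by lia_pos.
  by apply: H2; [rewrite res_shift | exact: start_shift].
case: (eqVneq (res k x) (res k q)) => [Ex|/eqP nq].
  have [c Ec] := (res_eqP k x q).1 Ex.
  have sB : start B (p + 1 + c * k.+1%:Z) x.
    rewrite Ec; apply: start_shift; split; first lia_pos.
      by rewrite addrK !inE eqxx.
    move=> y hy; rewrite !inE negb_or; apply/andP; split; last by apply: noA; lia_pos.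
    by apply/eqP; rewrite -(res_shift k y 0); apply: far; lia_pos.
  rewrite (start_uniq he sB) S2 //.
  have -> : x - (q - p) = p + c * k.+1%:Z by lia_pos.
  by rewrite H1 ?res_shift //; congr bead; lia_pos.
rewrite S3 //; case: (startB _ _ he) => [he'|[c [t [_ Ex ht]]]]; first exact: H2.
have [Et|net] := eqVneq t q; first by case: nq; rewrite Ex Et res_shift.
by have := noAc t c ltac:(lia_pos); rewrite -Ex xA.
Qed.

(** Deleting the end at the top bead of [nu] merges the first block with the next one, and this
    exchanges the runners at their two ends. *)
Lemma block_shift_strong_cover (k : nat) (A : {set 'I_k.+1}) (la nu : seq nat) :
  (1 < #|A|)%N -> is_core k.+1 la -> is_partition nu -> block_shift A la nu ->
  exists rho, [/\ is_core k.+1 rho, block_shift (A :\ res k (bd nu 0)) la rho,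
                  res k (bd nu 0) \in A, strong_cover k nu rho & bd nu 0 < bd rho 0].
Proof.
move=> cardA cl pn HA; have pl := core_partition cl.
have [a aA] : exists a, a \in A by apply/card_gt0P; lia_pos.
have cn := block_shift_core aA cl pn HA.
have [sp pA] := block_shift_top aA cl pn HA; have [dom H1 H2] := HA.
set l0 := bd la 0 in sp; set p := bd nu 0 in sp pA *.
have [le_lp l0A noA] := sp; have lt_p := start_lt sp.
(* A first block filling a whole period would leave only one residue in [A]. *)
have ne_p : p <> l0 - 1 + k.+1%:Z.
  move=> Ep; suff /subset_leq_card : A \subset [set res k p] by rewrite cards1; lia_pos.
  apply/subsetP => b bA; rewrite inE; have [le hb hno] := next_end_stop l0 bA.
  apply/negPn/negP => nb.
  have Ed : next_end A l0 = p.
    apply/eqP; rewrite eq_le; apply/andP; split; rewrite leNgt; apply/negP => lt.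
      by have := hno p; rewrite pA => /(_ ltac:(lia_pos)).
    by have := noA (next_end A l0); rewrite hb => /(_ ltac:(lia_pos)).
  have [e [h1 h2 h3]] : exists e, stop [set b] l0 e.
    by exists (next_end [set b] l0); apply: (@next_end_stop _ _ b); rewrite inE.
  move: h2; rewrite inE => /eqP Eb.
  have := noA e; rewrite Eb bA => h.
  case: (ltP e p) => [lt|ge]; first by have := h ltac:(lia_pos).
  have [Ee|/eqP nee] := eqVneq e p; first by rewrite -Eb Ee eqxx in nb.
  have := h3 (e - k.+1%:Z); rewrite res_sub Eb inE eqxx => hh.
  by have := hh ltac:(lia_pos).
have lt_p' : p < l0 - 1 + k.+1%:Z by lia_pos.
set A' := A :\ res k p.
have near x y : l0 - 1 <= x < l0 - 1 + k.+1%:Z -> l0 - 1 <= y < l0 - 1 + k.+1%:Z -> res k x = res k y -> x = y.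
  move=> hx hy E; have [le|lt] := leP x y; first by apply: (res_inj_near _ E); lia_pos.
  by apply/esym; apply: (res_inj_near _ (esym E)); lia_pos.
have l0A' : res k (l0 - 1) \in A'.
  by rewrite !inE l0A andbT; apply/eqP => E; have := near _ _ _ _ E; lia_pos.
have sub : A' \subset A by exact: subD1set.
have A'A x : res k x \notin A' -> res k x <> res k p -> res k x \notin A.
  by rewrite !inE negb_and negbK => /orP[/eqP->|].
have AA' x : res k x \notin A -> res k x \notin A'.
  by apply: contra; exact: (subsetP sub).
have sp' : start A' l0 p by split=> // y hy; apply/AA'/noA.
(* Where the start of a block changes, the new start [e] is a translate of the top bead of [la] and
   lies below the bead [t], hence at least one period below the top. *)
have dom' : block_dominant A' la.
  move=> e t he lt bt; have [e' he'] := start_exists t aA.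
  have [h1 h2 h3] := he; have [h1' h2' h3'] := he'.
  have [E|ne] := eqVneq e' e; first by subst e'; exact: dom he' lt bt.
  have le_e : e <= e'.
    rewrite leNgt; apply/negP => lte; have := h3' (e - 1).
    by rewrite (subsetP sub _ h2) => /(_ ltac:(lia_pos)).
  have : res k (e' - 1) \notin A' by apply: h3; lia_pos.
  rewrite !inE h2' andbT negbK => /eqP/res_eqP[c Ec].
  have : start A' (l0 + c * k.+1%:Z) (e' - 1) by rewrite Ec; exact: start_shift.
  have he1 : start A' e (e' - 1) by apply: start_sub_range he _; lia_pos.
  move=> /(start_uniq he1) Ee.
  have := bead_le_top pl bt; rewrite -/l0; have := start_lt he => ? ?.
  apply: (core_bead_le cl _ _ (bead_bd 0 pl)); rewrite -/l0.
    by rewrite res_add Ee res_shift.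
  have c_lt0 : c < 0 by nia_pos.
  by rewrite Ee; nia_pos.
have [rho [pr Hr Rr]] := block_shift_exists l0A' cl dom'.
have cr := block_shift_core l0A' cl pr Hr.
have [sq qA'] := block_shift_top l0A' cl pr Hr; have [_ H1' H2'] := Hr.
have qA := subsetP sub _ qA'.
have lt_q := start_lt sq.
have [_ _ noA'] := sq.
have mono := block_shift_mono l0A' sub cl pn pr HA Hr.
have lt_pq : p < bd rho 0.
  have := mono 0%N; rewrite -/p; case: (eqVneq p (bd rho 0)) => [E|]; last by lia_pos.
  by move: qA'; rewrite -E !inE eqxx.
(* Row [i + 1] of [rho] stays below row [i] of [la], hence below row [i] of [nu]. *)
have inter : interlace nu rho.
  move=> i; split=> //; have [h _] := block_shift_interlace aA cl pn HA i.
  by have [_ h'] := block_shift_interlace l0A' cl pr Hr i; lia_pos.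
set q := bd rho 0 in lt_pq sq qA' qA lt_q noA'.
have le_q : q <= l0 - 1 + k.+1%:Z by lia_pos.
have nop y : l0 <= y < l0 - 1 + k.+1%:Z -> y <> p -> res k y <> res k p.
  by move=> hy ne E; apply: ne; apply: near E; lia_pos.
have noAq y : p < y < q -> res k y \notin A.
  by move=> hy; apply: A'A; [apply: noA'; lia_pos | apply: nop; lia_pos].
have spq : start A (p + 1) q by split; [lia_pos | rewrite addrK | move=> y hy; apply: noAq; lia_pos].
exists rho; split=> //; split; first exact/containedP.
apply: swap_strong_cover => //; first by rewrite -/p -/q; lia_pos.
rewrite -/p -/q; split.
- move=> x /res_eqP[c ->]; have -> : p + c * k.+1%:Z + (q - p) = q + c * k.+1%:Z by lia_pos.
  rewrite (H2 (l0 + c * k.+1%:Z)) ?res_shift //; last exact: start_shift.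
  by rewrite (H2' (l0 + c * k.+1%:Z)) ?res_shift //; exact: start_shift.
- move=> x /res_eqP[c ->]; have -> : q + c * k.+1%:Z - (q - p) = p + c * k.+1%:Z by lia_pos.
  rewrite (H2 (p + 1 + c * k.+1%:Z)) ?res_shift //; last exact: start_shift.
  rewrite H1' ?res_shift //; last by rewrite !inE eqxx.
  by congr bead; lia_pos.
- move=> x np nq; have [xA'|xA'] := boolP (res k x \in A'); last first.
    by rewrite H1' // H1 //; exact: A'A.
  have xA := subsetP sub _ xA'; have [e he] := start_exists x aA.
  rewrite (H2 _ _ xA he) (H2' e) //; have [h1 h2 h3] := he; split=> //.
    rewrite !inE h2 andbT; apply/eqP => /res_eqP[c Ec].
    have le_x : x <= q + c * k.+1%:Z.
      rewrite leNgt; apply/negP => lt; have := h3 (q + c * k.+1%:Z).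
      by rewrite res_shift qA => /(_ ltac:(lia_pos)).
    have [Ex|ne] := eqVneq x (q + c * k.+1%:Z); first by apply: nq; rewrite Ex res_shift.
    have := noA' (x - c * k.+1%:Z) ltac:(lia_pos).
    by rewrite -mulNr res_shift xA'.
  by move=> y /h3/AA'.
move=> c t ht bt; rewrite H1 in bt; last by rewrite res_shift; exact: noAq.
rewrite (H2 (p + 1 + (c + 1) * k.+1%:Z)) ?res_shift //; last exact: start_shift.
have -> : p + 1 + (c + 1) * k.+1%:Z = p + 1 + c * k.+1%:Z + k.+1%:Z by lia_pos.
have st : start A (p + 1 + c * k.+1%:Z) (t + 1 + c * k.+1%:Z).
  by apply: start_shift; apply: start_sub_range spq _; lia_pos.
apply: dom st _ _; first lia_pos.
by suff <- : t + c * k.+1%:Z + 1 = t + 1 + c * k.+1%:Z by []; lia_pos.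
Qed.

Lemma bottom_strong_chain (k : nat) (la : seq nat) (m : nat) :
  (0 < k)%N -> is_core k.+1 la ->
  forall (A : {set 'I_k.+1}) nu, #|A| = m.+1 -> is_partition nu -> block_shift A la nu ->
  exists rho : nat -> seq nat,
    [/\ rho 0%N = nu /\ rho m = add_bottom_row k la,
        forall i, (i <= m)%N -> is_core k.+1 (rho i),
        forall i, (i < m)%N -> strong_cover k (rho i) (rho i.+1) &
        forall i, (1 <= i <= m)%N ->
          (0%N, (nth 0%N (rho i) 0).-1) \in skew (rho i) (rho i.-1)].
Proof.
move=> k_gt0 cl; have pl := core_partition cl.
elim: m => [|m IH] A nu cardA pn HA.
  have [a aA] : exists a, a \in A by apply/card_gt0P; lia_pos.
  have [dom _ _] := HA; have l0A := top_start aA cl dom.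
  have EA : A = [set res k (bd la 0 - 1)].
    have /cards1P[b Eb] : #|A| == 1%N by rewrite cardA.
    by move: l0A; rewrite Eb inE => /eqP->.
  have Enu : nu = add_bottom_row k la.
    apply: (block_shift_uniq aA pn (add_bottom_row_partition k_gt0 pl) HA).
    by rewrite EA; exact: block_shift_bottom_row.
  exists (fun=> nu); split=> // [i _|i]; last by lia_pos.
  exact: block_shift_core aA cl pn HA.
have [a aA] : exists a, a \in A by apply/card_gt0P; lia_pos.
have lt1 : (1 < #|A|)%N by rewrite cardA.
have [ga [cg Hg pA sc lt]] := block_shift_strong_cover lt1 cl pn HA.
have cardA' : #|A :\ res k (bd nu 0)| = m.+1.
  by have := cardsD1 (res k (bd nu 0)) A; rewrite pA cardA add1n => -[<-].
have [rho [[r0 rm] rc rs rt]] := IH _ _ cardA' (core_partition cg) Hg.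
exists (fun i => if i is j.+1 then rho j else nu); split=> //.
- by case=> [_|i]; [exact: block_shift_core aA cl pn HA | exact: rc].
- by case=> [_|i]; [rewrite r0 | exact: rs].
case=> // -[_|i]; last by move=> h; exact: rt.
by rewrite /= r0 mem_skew /=; move: lt; rewrite /bd; lia_pos.
Qed.

(** Each of the [k - l] covers merges two blocks and the last core has a single block, so [nu] has
    [k - l + 1] blocks. *)
Lemma bottom_strong_stripP (k l : nat) (la nu : seq nat) :
  (0 < k)%N -> (0 < l <= k)%N -> is_core k.+1 la -> is_core k.+1 nu ->
  bottom_strong_strip k l la nu <->
  exists A : {set 'I_k.+1}, (#|A| + l = k.+1)%N /\ block_shift A la nu.
Proof.
move=> k_gt0 /andP[l_gt0 l_le] cl cn.
have pl := core_partition cl; have pn := core_partition cn.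
have pg := add_bottom_row_partition k_gt0 pl.
have Hg := block_shift_bottom_row k_gt0 cl.
split=> [[rho [[r0 rm] rc rs /(horizontal_stripP pg pn) H rt]]|[A [cardA HA]]]; last first.
  have cardA' : #|A| = (k - l).+1 by lia_pos.
  have [rho [? ? ? ?]] := bottom_strong_chain k_gt0 cl cardA' pn HA.
  exists rho; split=> //; apply/horizontal_stripP => // i.
  have [a aA] : exists a, a \in A by apply/card_gt0P; lia_pos.
  have [dom _ _] := HA; have l0A := top_start aA cl dom.
  split; last first.
    have [h _] := block_shift_interlace aA cl pn HA i.
    by rewrite bd_add_bottom_rowS; lia_pos.
  by apply: (block_shift_mono (set11 _) _ cl pn pg HA Hg); rewrite sub1set.
pose m := (k - l)%N; rewrite -/m in rm rc rs rt.
have le_chain i j : (i <= j)%N -> (j <= m)%N -> forall r, bd (rho i) r <= bd (rho j) r.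
  move=> le_ij; rewrite -(subnK le_ij); elim: (j - i)%N => // d IH le_m r.
  rewrite addSn; have [/containedP h _] := rs (d + i)%N ltac:(lia_pos).
  by have := IH ltac:(lia_pos) r; have := h r; lia_pos.
(* Descend from the top of the chain; every strong cover adds one end. *)
suff H' d : (d <= m)%N -> exists A : {set 'I_k.+1}, #|A| = d.+1 /\ block_shift A la (rho (m - d)%N).
  by have [A [cA HA]] := H' m (leqnn _); exists A; rewrite subnn r0 in HA; split=> //; lia_pos.
elim: d => [_|d IH lt].
  by exists [set res k (bd la 0 - 1)]; rewrite cards1 subn0 rm.
have [A [cA HA]] := IH (ltnW lt); set i := (m - d.+1)%N.
have Ei : (m - d)%N = i.+1 by rewrite /i; lia_pos.
rewrite Ei in HA.
have [a aA] : exists a, a \in A by apply/card_gt0P; lia_pos.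
have lt_i : (i < m)%N by lia_pos.
have c1 := rc i (ltnW lt_i); have c2 := rc i.+1 lt_i.
have [/containedP hcon hdeg] := rs i lt_i.
(* Consecutive cores are squeezed between [nu] and [add_bottom_row k la], so they inherit the
   interlacing. *)
have inter : interlace (rho i) (rho i.+1).
  move=> r; split=> //; have [_ h] := H r.
  have := le_chain i.+1 m ltac:(lia_pos) (leqnn _) r.+1; rewrite rm.
  by have := le_chain 0%N i ltac:(lia_pos) (ltnW lt_i) r; rewrite r0; lia_pos.
have htop : bd (rho i) 0 < bd (rho i.+1) 0.
  by have := rt i.+1 ltac:(lia_pos); rewrite mem_skew /= /bd; lia_pos.
have hlow : bd la 0 <= bd (rho i) 0.
  have := le_chain 0%N i ltac:(lia_pos) (ltnW lt_i) 0%N; rewrite r0.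
  by have [_] := H 0%N; rewrite bd_add_bottom_rowS; lia_pos.
have hhigh : bd (rho i.+1) 0 < bd (rho i) 0 + k.+1%:Z.
  have := le_chain i.+1 m ltac:(lia_pos) (leqnn _) 0%N.
  by rewrite rm bd_add_bottom_row0; lia_pos.
have hrange : bd (rho i) 0 < bd (rho i.+1) 0 < bd (rho i) 0 + k.+1%:Z by lia_pos.
have sw := strong_cover_swap c1 c2 inter hdeg hrange.
have [pA HB] := strong_cover_shift aA cl c2 c1 HA hlow hrange sw.
by exists (res k (bd (rho i) 0) |: A); rewrite cardsU1 pA cA.
Qed.

(** * Weak covers *)

Definition content (c : cell) : int := c.2%:Z - c.1%:Z.

(** In a horizontal strip the cells of higher rows lie strictly further left, so columns and
    contents order the cells alike. *)
Lemma interlace_content (la nu : seq nat) (c d : cell) :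
  is_partition la -> is_partition nu -> interlace la nu ->
  c \in skew nu la -> d \in skew nu la -> (c.2 < d.2)%N = (content c < content d).
Proof.
move=> pl pn H; case: c d => [i j] [i' j']; rewrite !mem_skew /content /= => hc hd.
have aux a b : (a < b)%N -> (nth 0 nu b <= nth 0 la a)%N.
  by move=> lt; have := partition_nth_geq pn lt; have [_] := H a; rewrite /bd; lia.
have [lt|gt|E] := ltngtP i i'; [have := aux _ _ lt | have := aux _ _ gt |]; lia.
Qed.

Lemma rightmost_column_ge (S : seq cell) (c : cell) :
  c \in S -> (c.2 <= rightmost_column S)%N.
Proof. by move=> cS; rewrite /rightmost_column (big_rem c) //= leq_maxl. Qed.

Lemma rightmost_column_attained (S : seq cell) (c0 : cell) :
  c0 \in S -> exists2 c, c \in S & c.2 = rightmost_column S.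
Proof.
elim: S c0 => // d S IH c0 _; case: S IH => [_|d' S IH].
  by exists d; rewrite ?mem_head // /rightmost_column big_seq1.
have [c cS Ec] := IH d' (mem_head _ _).
rewrite /rightmost_column big_cons -[X in maxn _ X]/(rightmost_column (d' :: S)).
have [le|lt] := leqP d.2 (rightmost_column (d' :: S)).
  by exists c => //; rewrite inE cS orbT.
by exists d => //; rewrite mem_head.
Qed.

Lemma addableP (s : seq nat) (i j : nat) : is_partition s ->
  addable s (i, j) <-> j = nth 0%N s i /\ ~~ bead s (bd s i + 1).
Proof.
move=> ps; split=> [[]|[-> nb]].
  rewrite mem_cells /= -leqNgt => le_j [t [pt Et]].
  have tE i' j' : (j' < nth 0 t i')%N = ((i', j') == (i, j)) || (j' < nth 0 s i')%N.
    by have := Et (i', j'); rewrite inE !mem_cells.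
  have tij : (j < nth 0 t i)%N by rewrite tE eqxx.
  have Ej : j = nth 0%N s i.
    apply/eqP; rewrite eqn_leq le_j andbT leqNgt; apply/negP => lt.
    by have := tE i (nth 0%N s i); rewrite ltnn (ltn_trans lt tij) xpair_eqE; lia.
  split=> //; apply/negP => /beadP[i' Ei'].
  have lt_i : (i' < i)%N by apply: (bd_lt_idx ps); lia.
  have h1 := partition_nth_geq ps (ltnW lt_i).
  have E1 : nth 0%N s i' = j by move: Ei'; rewrite /bd; lia.
  have h2 := partition_nth_geq pt (ltnW lt_i).
  by have := tE i' j; rewrite E1 ltnn xpair_eqE; lia.
split; first by rewrite mem_cells /= ltnn.
have dec j' : (nth 0 s j'.+1 + (j'.+1 == i) <= nth 0 s j' + (j' == i))%N.
  have := partition_nth_geq ps (leqnSn j'); case: eqP => [E|]; last by lia.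
  rewrite leq_eqVlt => /orP[/eqP Eq|]; last by lia.
  case/negP: nb; have -> : bd s i + 1 = bd s j' by rewrite /bd -E; lia.
  exact: bead_bd.
have [|t pt Ht] := partition_exists (M := (size s + i).+1) dec.
  by rewrite nth_default; lia.
exists t; split=> // -[i' j']; rewrite inE !mem_cells /= Ht xpair_eqE.
by case: (eqVneq i' i) => [->|]; lia.
Qed.

(** The cell added to row [i] has content [bd be i + 1]; [a] is a position before the move, so the
    added residue is that of [a + 1]. *)
Definition moves (k : nat) (be : seq nat) (a : int) (i : nat) : bool :=
  ~~ bead be (bd be i + 1) && (res k (bd be i) == res k a).

Lemma res_succ (k : nat) (x y : int) : res k (x + 1) = res k (y + 1) <-> res k x = res k y.
Proof.
by split=> /res_eqP[c E]; apply/res_eqP; exists c; lia.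
Qed.

Lemma weak_coverP (k : nat) (be ga : seq nat) :
  is_partition be -> is_partition ga ->
  weak_cover k be ga <->
  exists a, [/\ bead be a, ~~ bead be (a + 1) &
                forall i, bd ga i = bd be i + (moves k be a i)%:Z].
Proof.
move=> pb pg.
have contE i : residue k (i, nth 0%N be i) = ((bd be i + 1) %% k.+1%:Z)%Z.
  by rewrite /residue /bd /=; congr modz; lia.
have resE i a : residue k (i, nth 0%N be i) = ((a + 1) %% k.+1%:Z)%Z <->
    res k (bd be i) = res k a.
  by rewrite contE -res_modz res_succ.
split=> [[ne [r Hr]]|[a [ba nba Ha]]].
  have rowE i : nth 0%N ga i = (nth 0%N be i +
      (~~ bead be (bd be i + 1) && (residue k (i, nth 0%N be i) == r)))%N.
    have H j : (j < nth 0 ga i)%N <-> (j < nth 0 be i)%N \/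
        j = nth 0%N be i /\ ~~ bead be (bd be i + 1) && (residue k (i, nth 0%N be i) == r).
      have := Hr (i, j); rewrite !mem_cells /= => ->; split.
        by case=> [|[/(addableP _ _ pb)[-> nb] <-]]; [left | right; rewrite nb eqxx].
      case=> [|[-> /andP[nb /eqP E]]]; [by left | right; split=> //].
      exact/addableP.
    move: H; case: (_ && _) => H; apply/eqP; rewrite eqn_leq;
      apply/andP; split; rewrite leqNgt; apply/negP => lt.
    - by have [h _] := H (nth 0%N ga i).-1; have := h ltac:(lia); lia.
    - have [_ h] := H (nth 0%N ga i); rewrite ltnn in h; apply: notF; apply: h.
      by lia.
    - by have [h _] := H (nth 0%N ga i).-1; have := h ltac:(lia); lia.
    have [_ h] := H (nth 0%N ga i); rewrite ltnn in h; apply: notF; apply: h.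
    by lia.
  have [i hi] : exists i, ~~ bead be (bd be i + 1) && (residue k (i, nth 0%N be i) == r).
    have [/hasP[i _ hi]|/hasPn no] := boolP (has (fun i => ~~ bead be (bd be i + 1) &&
        (residue k (i, nth 0%N be i) == r)) (iota 0 (size ga))); first by exists i.
    case: ne; apply: partition_eq => // i; rewrite rowE.
    have [lt|ge] := ltnP i (size ga).
      by rewrite (negbTE (no i _)) ?addn0 // mem_iota.
    by have := rowE i; rewrite nth_default //; lia.
  case/andP: hi => nb /eqP Er; exists (bd be i); split=> //; first exact: bead_bd.
  move=> i'; rewrite [LHS]/bd rowE /moves.
  have -> : (residue k (i', nth 0%N be i') == r) = (res k (bd be i') == res k (bd be i)).
    by apply/eqP/eqP => [E|/resE E]; [apply/resE; rewrite E -Er contE | rewrite E -Er contE].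
  by rewrite /bd; case: (_ && _); lia.
split.
  move=> E; have [i Ei] := beadP ba; have := Ha i.
  by rewrite E /moves -Ei nba eqxx /=; lia.
exists ((a + 1) %% k.+1%:Z)%Z => -[i j]; rewrite !mem_cells /=.
have Hi : nth 0%N ga i = (nth 0%N be i + moves k be a i)%N.
  by have := Ha i; rewrite /bd; lia.
rewrite Hi; split=> [lt|[|[/(addableP _ _ pb)[-> nb] /resE E]]].
- have [|ge] := ltnP j (nth 0%N be i); [by left | right].
  have [Ej mv] : j = nth 0%N be i /\ moves k be a i by case: (moves k be a i) lt; lia.
  by case/andP: mv => nb /eqP E; subst j; split; [exact/addableP | apply/resE].
- by lia.
by rewrite /moves nb E eqxx /=; lia.
Qed.

Lemma weak_cover_contained (k : nat) (be ga : seq nat) :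
  weak_cover k be ga -> forall i, bd be i <= bd ga i.
Proof. by case=> _ [r Hr]; apply/containedP => c hc; apply/Hr; left. Qed.

Definition adjacent_swap (k : nat) (a : int) (be ga : seq nat) : Prop :=
  [/\ forall x, res k x = res k (a + 1) -> bead ga x = bead be (x - 1),
      forall x, res k x = res k a -> bead ga x = bead be (x + 1) &
      forall x, res k x <> res k a -> res k x <> res k (a + 1) -> bead ga x = bead be x].

(** The runner of [a + 1] stops before [a + 1], while that of [a] reaches [a]. *)
Lemma runner_strict (k : nat) (be : seq nat) (a x : int) :
  is_core k.+1 be -> bead be a -> ~~ bead be (a + 1) ->
  res k x = res k (a + 1) -> bead be x -> bead be (x - 1 + k.+1%:Z).
Proof.
move=> cb ba nba E bx.
have lt : x < a + 1.
  by rewrite ltNge; apply: contra nba => le; exact: (core_bead_le cb (esym E) le bx).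
have /res_eqP[c Ec] := E.
apply: (core_bead_le cb _ _ ba); first by apply/res_eqP; exists (c + 1); lia_pos.
have c_lt0 : c < 0 by nia_pos.
by nia_pos.
Qed.

Lemma res_succ_neq (k : nat) (x : int) : (0 < k)%N -> res k (x + 1) <> res k x.
Proof.
move=> k_gt0 /esym E; have : x = x + 1 by apply: (res_inj_near _ E); lia.
by lia.
Qed.

(** The moving beads are exactly the excess of the runner of [a] over that of [a + 1]; transferring
    it exchanges the two runners. *)
Lemma moves_swap (k : nat) (a : int) (be ga : seq nat) :
  (0 < k)%N -> is_core k.+1 be -> is_partition ga ->
  bead be a -> ~~ bead be (a + 1) ->
  (forall i, bd ga i = bd be i + (moves k be a i)%:Z) ->
  adjacent_swap k a be ga.
Proof.
move=> k_gt0 cb pg ba nba Ha; have pb := core_partition cb.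
have nea := @res_succ_neq k a k_gt0.
have strict x : res k x = res k (a + 1) -> bead be x -> bead be (x - 1).
  move=> E /(runner_strict cb ba nba E)/(core_bead_sub cb).
  by rewrite addrK.
have ga_mv i : moves k be a i -> bead ga (bd be i + 1).
  by move=> mv; have := Ha i; rewrite mv => <-; exact: bead_bd.
have ga_st i : ~~ moves k be a i -> bead ga (bd be i).
  by move=> /negbTE mv; have := Ha i; rewrite mv addr0 => <-; exact: bead_bd.
split.
- move=> x Ex; have Ex1 : res k (x - 1) = res k a by apply/res_succ; rewrite subrK.
  apply/idP/idP => [/beadP[i]|/beadP[i Ei]].
    rewrite Ha; case mv: (moves k be a i) => /= Ei.
      by rewrite Ei addrK bead_bd.
    by apply: strict => //; rewrite Ei addr0 bead_bd.
  have [/beadP[j Ej]|nb] := boolP (bead be x).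
    by rewrite Ej; apply: ga_st; rewrite /moves -Ej Ex (introF eqP nea) andbF.
  have -> : x = bd be i + 1 by lia.
  by apply: ga_mv; rewrite /moves -Ei subrK nb Ex1 eqxx.
- move=> x Ex; apply/idP/idP => [/beadP[i]|].
    rewrite Ha; case mv: (moves k be a i) => /= Ei.
      case/andP: mv => _ /eqP E; case: (@res_succ_neq k (bd be i) k_gt0).
      by rewrite E -Ex Ei.
    rewrite addr0 in Ei; subst x; move: mv; rewrite /moves Ex eqxx andbT.
    by move/negbFE.
  move=> bx1; have bx : bead be x.
    by rewrite -[x](addrK 1); apply: strict => //; apply/res_succ.
  have [i Ei] := beadP bx; rewrite Ei; apply: ga_st.
  by rewrite /moves -Ei bx1.
move=> x n1 n2; apply/idP/idP => [/beadP[i]|/beadP[i Ei]].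
  rewrite Ha; case mv: (moves k be a i) => /= Ei.
    by case: n2; case/andP: mv => _ /eqP E; rewrite Ei; apply/res_succ.
  by rewrite Ei addr0 bead_bd.
by rewrite Ei; apply: ga_st; rewrite /moves -Ei (introF eqP n1) andbF.
Qed.

(** The row formula defines a partition that, by [moves_swap], has the same beads as [ga]. *)
Lemma swap_moves (k : nat) (a : int) (be ga : seq nat) :
  (0 < k)%N -> is_core k.+1 be -> is_partition ga ->
  bead be a -> ~~ bead be (a + 1) -> adjacent_swap k a be ga ->
  forall i, bd ga i = bd be i + (moves k be a i)%:Z.
Proof.
move=> k_gt0 cb pg ba nba [S1 S2 S3]; have pb := core_partition cb.
have nbS i : ~~ moves k be a i.+1 \/ (nth 0 be i.+1 < nth 0 be i)%N.
  have := partition_nth_geq pb (leqnSn i); rewrite leq_eqVlt => /orP[/eqP E|]; last by right.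
  left; rewrite /moves; have -> : bd be i.+1 + 1 = bd be i by rewrite /bd; lia.
  by rewrite bead_bd.
have [i||ga' pg' Hg] := @partition_exists (fun i => nth 0 be i + moves k be a i)%N (size be).+1.
- by have := partition_nth_geq pb (leqnSn i); case: (nbS i); case: (moves k be a i.+1); lia.
- by have := nbS (size be); rewrite !nth_default // => -[/negbTE->|//].
have Ha i : bd ga' i = bd be i + (moves k be a i)%:Z by rewrite /bd Hg; lia.
have [T1 T2 T3] := moves_swap k_gt0 cb pg' ba nba Ha.
suff -> : ga = ga' by [].
apply: bead_eq => // x.
have [E|/eqP n1] := eqVneq (res k x) (res k a); first by rewrite S2 // T2.
have [E|/eqP n2] := eqVneq (res k x) (res k (a + 1)); first by rewrite S1 // T1.
by rewrite S3 // T3.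
Qed.

(** * Merging a block with a following singleton block *)

Lemma start_setD1 (k : nat) (A : {set 'I_k.+1}) (a e t : int) :
  res k a \in A -> res k (a + 1) \in A -> start (A :\ res k a) e t ->
  start A e t \/ res k t = res k (a + 1) /\ start A e (t - 1).
Proof.
move=> aA a1A he; have [h1 h2 h3] := he.
have [e' he'] := start_exists t aA; have [h1' h2' h3'] := he'.
have [<-|ne] := eqVneq e' e; [by left | right].
have eA : res k (e - 1) \in A by move: h2; rewrite !inE => /andP[].
have le_e : e <= e'.
  by rewrite leNgt; apply/negP => lt; have := h3' (e - 1); rewrite eA => /(_ ltac:(lia_pos)).
have : res k (e' - 1) \notin A :\ res k a by apply: h3; lia_pos.
rewrite !inE h2' andbT negbK => /eqP E.
have E' : res k e' = res k (a + 1) by rewrite -[e'](subrK 1); apply/res_succ.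
have Et : t = e'.
  apply/eqP; rewrite eq_le h1' andbT leNgt; apply/negP => lt.
  by have := h3' e'; rewrite E' a1A => /(_ ltac:(lia_pos)).
subst e'; split=> //; split=> //; first by lia_pos.
move=> y hy; have := h3 y ltac:(lia_pos); rewrite !inE negb_and negbK => /orP[/eqP Ey|//].
have lt := start_lt he.
have : y = t - 1 by apply: (@res_inj_near k); [lia_pos | rewrite Ey E].
by lia_pos.
Qed.

Lemma start_setU1 (k : nat) (A : {set 'I_k.+1}) (a e t : int) :
  res k (a + 1) \in A -> start (res k a |: A) e t ->
  start A e t \/ res k t = res k (a + 1) /\ t = e.
Proof.
move=> a1A [h1 h2 h3]; move: h2; rewrite !inE => /orP[/eqP E|h2]; last first.
  by left; split=> // y /h3; rewrite !inE negb_or => /andP[].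
have E' : res k e = res k (a + 1) by rewrite -[e](subrK 1); apply/res_succ.
have Et : t = e; last by right; rewrite Et.
apply/eqP; rewrite eq_le h1 andbT leNgt; apply/negP => lt.
by have := h3 e; rewrite E' !inE a1A orbT => /(_ ltac:(lia_pos)).
Qed.

Lemma start_pred (k : nat) (A : {set 'I_k.+1}) (a e t : int) :
  res k a \notin A -> start A e t -> res k t = res k (a + 1) ->
  start (res k a |: A) e (t - 1).
Proof.
move=> aA he E; have [h1 h2 h3] := he; have lt := start_lt he.
have Et : res k (t - 1) = res k a by apply/res_succ; rewrite subrK.
have ne : e <> t by move=> Ee; move: h2; rewrite Ee Et (negbTE aA).
split; [by lia_pos | by rewrite !inE h2 orbT |].
move=> y hy; rewrite !inE negb_or h3 ?andbT; last by lia_pos.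
apply/eqP => Ey; have : y = t - 1 by apply: (@res_inj_near k); [lia_pos | rewrite Ey Et].
by lia_pos.
Qed.

Lemma start_setU1_neq (k : nat) (A : {set 'I_k.+1}) (a e t : int) :
  res k (a + 1) \in A -> start A e t -> res k t <> res k (a + 1) ->
  start (res k a |: A) e t.
Proof.
move=> a1A [h1 h2 h3] ne; split=> //; first by rewrite !inE h2 orbT.
move=> y hy; rewrite !inE negb_or h3 // andbT; apply/eqP => /res_succ Ey.
have [Et|net] := eqVneq (y + 1) t; first by apply: ne; rewrite -Et.
by have := h3 (y + 1); rewrite Ey a1A => /(_ ltac:(lia_pos)).
Qed.

(** The block ending at [a] absorbs the singleton block of [a + 1]. In [be] these positions carry
    the runners of [la] at the block start and at [a + 1], so [runner_strict] is the dominance of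
    the merged block. *)
Lemma weak_cover_shift (k : nat) (A : {set 'I_k.+1}) (a : int) (la be ga : seq nat) :
  is_core k.+1 be -> block_shift A la be ->
  res k a \in A -> res k (a + 1) \in A ->
  bead be a -> ~~ bead be (a + 1) -> adjacent_swap k a be ga ->
  block_shift (A :\ res k a) la ga.
Proof.
move=> cb [dom H1 H2] aA a1A ba nba [S1 S2 S3].
have here x : res k x = res k (a + 1) -> start A x x.
  move=> E; apply: start_here; suff -> : res k (x - 1) = res k a by [].
  by apply/res_succ; rewrite subrK.
have predA x : res k x = res k (a + 1) -> res k (x - 1) \in A.
  by move=> E; suff -> : res k (x - 1) = res k a by []; apply/res_succ; rewrite subrK.
split.
- move=> e t he lt bt; case: (start_setD1 aA a1A he) => [he'|[E he']]; first exact: dom he' lt bt.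
  have : bead be t by rewrite (H2 t) ?E //; exact: here.
  move=> /(runner_strict cb ba nba E).
  rewrite (H2 (e + k.+1%:Z)) ?res_add //; first exact: predA.
  exact: start_add.
- move=> x; rewrite !inE negb_and negbK => /orP[/eqP E|xA].
    have E1 : res k (x + 1) = res k (a + 1) by apply/res_succ.
    by rewrite S2 // (H2 (x + 1)) ?E1 //; exact: here.
  rewrite S3 ?H1 //; first by move=> E; move: xA; rewrite E aA.
  by move=> E; move: xA; rewrite E a1A.
move=> e x; rewrite !inE => /andP[/eqP ne xA] he.
have [E|/eqP n1] := eqVneq (res k x) (res k (a + 1)).
  rewrite S1 //; case: (start_setD1 aA a1A he) => [he'|[_ he']].
    have Ee := start_uniq he' (here _ E); subst e.
    case: he => _; rewrite !inE => /andP[/eqP np _] _; case: np.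
    by apply/res_succ; rewrite subrK.
  by apply: H2 => //; exact: predA.
rewrite S3 //; case: (start_setD1 aA a1A he) => [he'|[//]].
exact: H2.
Qed.

(* Undoing the weak cover that adds the largest content [z]. *)
Lemma block_shift_weak_cover (k : nat) (A : {set 'I_k.+1}) (a0 : 'I_k.+1) (z : int) (la nu : seq nat) :
  (0 < k)%N -> a0 \in A -> is_core k.+1 la -> is_partition nu -> block_shift A la nu ->
  res k (z - 1) \notin A -> res k z \in A -> bead nu z -> ~~ bead nu (z + k.+1%:Z) ->
  exists mu, [/\ is_core k.+1 mu, block_shift (res k (z - 1) |: A) la mu,
                 bead mu (z - 1), ~~ bead mu z & adjacent_swap k (z - 1) mu nu].
Proof.
move=> k_gt0 aA cl pn HA z1A zA bz nbz; have [dom H1 H2] := HA.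
pose a := z - 1; have Ez : z = a + 1 by rewrite /a subrK.
rewrite -/a in z1A *; rewrite Ez in zA bz nbz *.
set B := res k a |: A; have aB : res k a \in B by rewrite !inE eqxx.
have AB x : res k x \in A -> res k x \in B by rewrite !inE => ->; rewrite orbT.
have domB : block_dominant B la.
  move=> e t he lt bt; case: (start_setU1 zA he) => [he'|[_ Et]]; last by lia_pos.
  exact: dom he' lt bt.
have [mu [pm Hm _]] := block_shift_exists aB cl domB.
have cm := block_shift_core aB cl pm Hm; have [_ M1 M2] := Hm.
have here x : res k x = res k (a + 1) -> start B x x.
  move=> E; apply: start_here; suff -> : res k (x - 1) = res k a by [].
  by apply/res_succ; rewrite subrK.
have muz x : res k x = res k (a + 1) -> bead mu x = bead la x.
  by move=> E; apply: M2; [rewrite E; exact: AB | exact: here].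
have mup x : res k x = res k (a + 1) -> bead nu x = bead mu (x - 1).
  move=> E; have [e he] := start_exists x aA.
  rewrite (H2 e) ?E // (M2 e) //; last exact: start_pred.
  by suff -> : res k (x - 1) = res k a by []; apply/res_succ; rewrite subrK.
exists mu; split=> //.
- by rewrite -[a](addrK 1) -mup.
(* A bead of [la] at [z] would by dominance give one a period above its block start, which the
   rotation carries to [z + k + 1]. *)
- rewrite muz //; apply: contra nbz => bla.
  have [e he] := start_exists (a + 1) aA.
  rewrite (H2 (e + k.+1%:Z)) ?res_add //; last exact: start_add.
  apply: (dom _ _ he _ bla); have [h1 h2 _] := he.
  rewrite lt_neqAle h1 andbT; apply/eqP => Ee.
  by move: h2; rewrite Ee addrK (negbTE z1A).
split=> // [x Ex|x n1 n2].
  by rewrite H1 ?Ex // muz //; apply/res_succ.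
have [xA|xA] := boolP (res k x \in A).
  have [e he] := start_exists x aA.
  rewrite (H2 _ _ xA he) (M2 e) //; first exact: AB.
  exact: start_setU1_neq.
by rewrite H1 // M1 // !inE negb_or xA andbT; apply/eqP.
Qed.

Lemma block_shift_setT (k : nat) (la : seq nat) : block_shift [set: 'I_k.+1] la la.
Proof.
have startT e x : start [set: 'I_k.+1] e x -> e = x.
  case=> le _ h; apply/eqP; rewrite eq_le le leNgt; apply/negP => lt.
  by have := h e; rewrite inE => /(_ ltac:(lia)).
split=> [e t /startT->|x|e x _ /startT->] //; first by lia.
by rewrite inE.
Qed.

(** * Chains of weak covers *)

Lemma weak_chain_mono (k l : nat) (ga : nat -> seq nat) :
  (forall i, (i < l)%N -> weak_cover k (ga i) (ga i.+1)) ->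
  forall i j, (i <= j)%N -> (j <= l)%N -> forall r, bd (ga i) r <= bd (ga j) r.
Proof.
move=> wc i j le_ij; rewrite -(subnK le_ij); elim: (j - i)%N => // d IH le_l r.
rewrite addSn; have h := weak_cover_contained (wc (d + i)%N ltac:(lia)) r.
by have := IH ltac:(lia) r; lia.
Qed.

Lemma skew_sub (la nu be ga : seq nat) (c : cell) :
  (forall r, bd la r <= bd be r) -> (forall r, bd ga r <= bd nu r) ->
  c \in skew ga be -> c \in skew nu la.
Proof.
by move=> h1 h2; rewrite !mem_skew; have := h1 c.1; have := h2 c.1; rewrite /bd; lia.
Qed.

Lemma mem_skew_moves (k : nat) (a : int) (be ga : seq nat) (c : cell) :
  (forall i, bd ga i = bd be i + (moves k be a i)%:Z) ->
  c \in skew ga be ->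
  [/\ moves k be a c.1, content c = bd be c.1 + 1 & content c = bd ga c.1].
Proof.
case: c => i j Ha; rewrite mem_skew /content /=; have := Ha i.
by case: (moves k be a i) => /= E h; split=> //; move: E h; rewrite /bd; lia.
Qed.

Lemma moves_mem_skew (k : nat) (a : int) (be ga : seq nat) (i : nat) :
  (forall i, bd ga i = bd be i + (moves k be a i)%:Z) -> moves k be a i ->
  (i, nth 0%N be i) \in skew ga be.
Proof.
by move=> Ha mv; have := Ha i; rewrite mv mem_skew /bd /=; lia.
Qed.

(** The chain is built from its end: the last cover has top content [z], the largest bead of [nu] at
    the end of a block with more than one position. The final clause on the last cover carries the
    induction, since it allows earlier contents to be compared with [z]. *)
Lemma weak_chain_exists (k l : nat) (la : seq nat) :
  (0 < k)%N -> is_core k.+1 la ->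
  forall (A : {set 'I_k.+1}) nu, (0 < #|A|)%N -> (#|A| + l = k.+1)%N ->
  is_partition nu -> block_shift A la nu ->
  exists ga : nat -> seq nat,
    [/\ ga 0%N = la /\ ga l = nu,
        forall i, (i <= l)%N -> is_core k.+1 (ga i),
        forall i, (i < l)%N -> weak_cover k (ga i) (ga i.+1),
        forall i, (1 <= i <= l.-1)%N ->
          (rightmost_column (skew (ga i) (ga i.-1))
            < rightmost_column (skew (ga i.+1) (ga i)))%N &
        forall c, c \in skew (ga l) (ga l.-1) ->
          res k (content c - 1) \notin A /\
          exists2 e, start A e (content c) & bead la e].
Proof.
move=> k_gt0 cl; have pl := core_partition cl.
elim: l => [|l IH] A nu A_gt0 cardA pn HA; have /card_gt0P[a0 aA] := A_gt0.
  have EA : A = [set: 'I_k.+1].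
    by apply/eqP; rewrite eqEcard subsetT cardsT card_ord; lia_pos.
  have Enu : nu = la.
    by apply: (block_shift_uniq aA pn pl HA); rewrite EA; exact: block_shift_setT.
  exists (fun=> la); split=> // [i|c]; first by lia_pos.
  by rewrite mem_skew; lia_pos.
have cn := block_shift_core aA cl pn HA.
have top x : bead nu x -> x <= bd nu 0 by exact: bead_le_top.
have [z [z1A zA bz zmax]] : exists z, [/\ res k (z - 1) \notin A, res k z \in A, bead nu z &
    forall x, res k (x - 1) \notin A -> res k x \in A -> bead nu x -> x <= z].
  pose C x := [&& res k (x - 1) \notin A, res k x \in A & bead nu x].
  have ex : exists m : nat, C (bd nu 0 - m%:Z).
    have [b bA] : exists b, b \notin A.
      have : ~~ ([set: 'I_k.+1] \subset A).
        by apply/negP => /subset_leq_card; rewrite cardsT card_ord; lia_pos.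
      by case/subsetPn => b _ bA; exists b.
    (* So far down every position is a bead, and the first end after a position that is not an end
       meets the conditions. *)
    pose w := b%:Z - (b + size nu + k.+2 + absz (bd nu 0))%N%:Z * k.+1%:Z.
    have w_lt : w + k.+1%:Z < bd nu 0 /\ w + k.+1%:Z < - (size nu)%:Z.
      by rewrite /w; split; nia.
    have wA : res k w \notin A by rewrite /w -mulNr res_shift res_ord.
    have [d1 d2 d3] := next_end_stop w aA; set d := next_end A w in d1 d2 d3.
    have d_lt : d <= w + k.+1%:Z.
      rewrite leNgt; apply/negP => lt.
      have := d3 (d - k.+1%:Z); rewrite res_sub d2 => h.
      by have := h ltac:(lia_pos).
    have ne : w <> d by move=> E; move: wA; rewrite E d2.
    exists (absz (bd nu 0 - d)%R).
    have -> : bd nu 0 - (absz (bd nu 0 - d)%R)%:Z = d by lia_pos.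
    apply/and3P; split=> //; first by apply: d3; lia_pos.
    by apply: bead_low => //; lia_pos.
  case: (ex_minnP ex) => m /and3P[h1 h2 h3] minm; exists (bd nu 0 - m%:Z); split=> //.
  move=> x x1 x2 x3; have le := top _ x3.
  have := minm (absz (bd nu 0 - x)%R).
  have -> : bd nu 0 - (absz (bd nu 0 - x)%R)%:Z = x by lia_pos.
  by rewrite /C x1 x2 x3 => /(_ isT); lia_pos.
have nbz : ~~ bead nu (z + k.+1%:Z).
  apply/negP => h; have := zmax (z + k.+1%:Z); rewrite res_add.
  have -> : z + k.+1%:Z - 1 = z - 1 + k.+1%:Z by lia_pos.
  by rewrite res_add => /(_ z1A zA h); lia_pos.
have [mu [cm Hm bmu nbmu sw]] := block_shift_weak_cover k_gt0 aA cl pn HA z1A zA bz nbz.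
have pm := core_partition cm.
have nbmu' : ~~ bead mu (z - 1 + 1) by rewrite subrK.
have rows := swap_moves k_gt0 cm pn bmu nbmu' sw.
have wcn : weak_cover k mu nu by apply/weak_coverP => //; exists (z - 1).
have cardB : #|res k (z - 1) |: A| = #|A|.+1 by rewrite cardsU1 z1A.
have [|||//|ga [[g0 gl] gc gw gr gm]] := IH (res k (z - 1) |: A) mu.
- by rewrite cardB.
- by rewrite cardB addSnnS.
- exact: pm.
pose ga' i := if (i <= l)%N then ga i else nu.
have ga'E i : (i <= l)%N -> ga' i = ga i by rewrite /ga' => ->.
have ga'S : ga' l.+1 = nu by rewrite /ga' ltnn.
have inter := block_shift_interlace aA cl pn HA.
have muskew c : c \in skew nu mu -> c \in skew nu la.
  apply: skew_sub => // r; rewrite -g0 -gl.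
  exact: (weak_chain_mono gw).
exists ga'; split.
- by split.
- move=> i; rewrite leq_eqVlt => /orP[/eqP->|lt]; first by rewrite ga'S.
  by rewrite ga'E //; exact: gc.
- move=> i; rewrite ltnS leq_eqVlt => /orP[/eqP->|lt].
    by rewrite ga'S ga'E // gl.
  by rewrite !ga'E //; [exact: gw | exact: ltnW].
- move=> i /= /andP[i_gt0]; rewrite leq_eqVlt => /orP[/eqP Ei|lt]; last first.
    rewrite !ga'E //; [apply: gr; lia_pos | lia_pos | lia_pos].
  subst i; rewrite ga'S !ga'E //; last by lia_pos.
  have [i Ei] := beadP bmu.
  have mv : moves k mu (z - 1) i by rewrite /moves -Ei nbmu' eqxx.
  have cS := moves_mem_skew rows mv; have [_ cE _] := mem_skew_moves rows cS.
  set c := (i, nth 0%N mu i) in cS cE.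
  have czE : content c = z by rewrite cE -Ei subrK.
  have wl : weak_cover k (ga l.-1) (ga l) by have := gw l.-1; rewrite prednK //; apply; lia_pos.
  have pl1 := core_partition (gc l.-1 (leq_pred l)).
  have pl2 := core_partition (gc l (leqnn l)).
  have [a [ba nba rows']] := (weak_coverP _ pl1 pl2).1 wl.
  have [j Ej] := beadP ba.
  have mv' : moves k (ga l.-1) a j by rewrite /moves -Ej nba eqxx.
  have [d dS dE] := rightmost_column_attained (moves_mem_skew rows' mv').
  rewrite -dE; apply: leq_trans (rightmost_column_ge (S := skew nu (ga l)) (c := c) _).
    (* The block of [content d] starts at a bead of [la], so it ends at a bead of [nu], which is at
       most [z]. The residue condition excludes [content d = z], hence [d] lies left of [c]. *)
    have [d1B [e he be]] := gm _ dS.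
    have dS' : d \in skew nu la.
      apply: skew_sub dS => r; last by rewrite gl; exact: (weak_cover_contained wcn).
      by rewrite -g0; apply: (weak_chain_mono gw) => //; exact: leq_pred.
    rewrite (interlace_content pl pn inter dS' (muskew _ cS)) czE.
    move: d1B; rewrite !inE negb_or => /andP[/eqP ned d1A].
    have neq : content d <> z by move=> E; apply: ned; rewrite E.
    have he' : start A e (content d).
      case: (@start_setU1 k A (z - 1) e (content d)) => //; first by rewrite subrK.
      rewrite subrK => -[E _]; case: ned.
      by apply/res_succ; rewrite !subrK.
    have [h1 h2 h3] := next_end_stop (content d) aA.
    have [s1 s2 s3] := he'.
    have send : start A e (next_end A (content d)).
      split=> // [|y hy]; first by lia_pos.
      by case: (ltP y (content d)) => hyd; [apply: s3; lia_pos | apply: h3; lia_pos].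
    have [_ _ H2] := HA.
    have := zmax (next_end A (content d)); rewrite (H2 _ _ h2 send) be.
    case: (eqVneq (next_end A (content d)) (content d)) => [E|ne].
      by rewrite E in h2 *; move=> /(_ d1A h2 isT); lia_pos.
    move=> h; have := h (h3 (next_end A (content d) - 1) ltac:(lia_pos)) h2 isT.
    by lia_pos.
  by rewrite gl.
move=> c; rewrite ga'S /= ga'E // gl => cS.
have [mv cE cE'] := mem_skew_moves rows cS.
case/andP: mv => _ /eqP Er.
have E1 : res k (content c - 1) = res k (z - 1) by rewrite cE addrK.
have Ez : res k (content c) = res k z.
  by rewrite -[content c](subrK 1) -[z in RHS](subrK 1); apply/res_succ.
rewrite E1; split=> //; have [e he] := start_exists (content c) aA.
exists e => //; have [_ _ H2] := HA.
by rewrite -(H2 e (content c)) ?Ez // cE' bead_bd.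
Qed.

Lemma weak_stripP (k l : nat) (la nu : seq nat) :
  (0 < k)%N -> (0 < l <= k)%N -> is_core k.+1 la -> is_core k.+1 nu ->
  weak_strip k l nu la <->
  exists A : {set 'I_k.+1}, (#|A| + l = k.+1)%N /\ block_shift A la nu.
Proof.
move=> k_gt0 /andP[l_gt0 l_le] cl cn.
have pl := core_partition cl; have pn := core_partition cn.
split=> [[ga [[g0 gl] gc gw /(horizontal_stripP pn pl) H gr]]|[A [cardA HA]]]; last first.
  have A_gt0 : (0 < #|A|)%N by lia_pos.
  have [ga [? ? ? ? _]] := weak_chain_exists k_gt0 cl A_gt0 cardA pn HA.
  have /card_gt0P[a0 aA] := A_gt0.
  exists ga; split=> //; apply/horizontal_stripP => //.
  exact: block_shift_interlace aA cl pn HA.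
have mono := weak_chain_mono gw.
have skewS i c : (i < l)%N -> c \in skew (ga i.+1) (ga i) -> c \in skew nu la.
  move=> lt; apply: skew_sub => r; first by rewrite -g0; apply: mono; lia_pos.
  by rewrite -gl; apply: mono; lia_pos.
(* A position [y] once left by a bead which was at most at [y] in [la] cannot
   be occupied again, because [nu / la] is a horizontal strip. *)
have vacant i R y : (i <= l)%N -> bd la R <= y -> y < bd (ga i) R ->
    forall j, (i <= j <= l)%N -> bead (ga j) y = false.
  move=> le_i le_y lt_y j /andP[le_ij le_jl]; apply/negP => /beadP[R' ER'].
  have pj := core_partition (gc _ le_jl).
  have lt_R : (R < R')%N by apply: (bd_lt_idx pj); have := mono _ _ le_ij le_jl R; lia_pos.
  case: R' ER' lt_R => // R' ER' lt_R.
  have := mono _ _ le_jl (leqnn l) R'.+1; rewrite gl.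
  by have [_] := H R'; have := bd_leq pl (lt_R : (R <= R')%N); lia_pos.
(* For each residue no longer in [A], the third clause records a vacated position [y] below the bead
   that adds the rightmost cell of the next cover. *)
suff inv i : (i <= l)%N -> exists A : {set 'I_k.+1}, [/\ (#|A| + i = k.+1)%N,
    block_shift A la (ga i) &
    forall q, q \notin A -> exists y R, [/\ res k y = q, bd la R <= y, y < bd (ga i) R &
      forall c, (i < l)%N -> c \in skew (ga i.+1) (ga i) ->
        c.2 = rightmost_column (skew (ga i.+1) (ga i)) -> y + 1 < content c]].
  by have [A [cA HA _]] := inv l (leqnn l); rewrite gl in HA; exists A.
elim: i => [_|i IH lt_i].
  exists [set: 'I_k.+1]; rewrite cardsT card_ord addn0 g0; split=> //.
    exact: block_shift_setT.
  by move=> q; rewrite inE.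
have [A [cardA HA Hq]] := IH (ltnW lt_i).
have ci := gc i (ltnW lt_i); have ci1 := gc i.+1 lt_i.
have pi := core_partition ci; have pi1 := core_partition ci1.
have [a [ba nba rows]] := (weak_coverP _ pi pi1).1 (gw i lt_i).
have sw := moves_swap k_gt0 ci pi1 ba nba rows.
have [j Ej] := beadP ba.
have mv : moves k (ga i) a j by rewrite /moves -Ej nba eqxx.
have [c cS cmax] := rightmost_column_attained (moves_mem_skew rows mv).
have [/andP[_ /eqP Er] cE cE'] := mem_skew_moves rows cS.
have bc1 : bead (ga i) (content c - 1) by rewrite cE addrK bead_bd.
have bc : bead (ga i.+1) (content c) by rewrite cE' bead_bd.
have Ec1 : res k (content c - 1) = res k a by rewrite cE addrK.
have Ec : res k (content c) = res k (a + 1).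
  by rewrite -[content c](subrK 1); apply/res_succ.
(* Otherwise the bead at [content c - 1] forces, by the core property, a bead at the vacated [y]. *)
have aA : res k a \in A.
  apply/negPn/negP => /Hq[y [R [Ey le_y lt_y /(_ c lt_i cS cmax) lt]]].
  have := vacant i R y (ltnW lt_i) le_y lt_y i; rewrite leqnn (ltnW lt_i) => /(_ isT).
  by rewrite (core_bead_le ci _ _ bc1) //; [rewrite Ey Ec1 | lia_pos].
(* The same conflict after the cover, with the new bead at [content c]. *)
have a1A : res k (a + 1) \in A.
  apply/negPn/negP => /Hq[y [R [Ey le_y lt_y /(_ c lt_i cS cmax) lt]]].
  have := vacant i R y (ltnW lt_i) le_y lt_y i.+1; rewrite leqnSn lt_i => /(_ isT).
  by rewrite (core_bead_le ci1 _ _ bc) //; [rewrite Ey Ec | lia_pos].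
exists (A :\ res k a); split.
- by move: cardA; rewrite (cardsD1 (res k a)) aA add1n addSn addnS.
- exact: weak_cover_shift ci HA aA a1A ba nba sw.
have next d : (i.+1 < l)%N -> d \in skew (ga i.+2) (ga i.+1) ->
    d.2 = rightmost_column (skew (ga i.+2) (ga i.+1)) -> content c < content d.
  move=> lt dS dmax.
  rewrite -(interlace_content pl pn H (skewS _ _ lt_i cS) (skewS _ _ lt dS)).
  by rewrite cmax dmax; apply: (gr i.+1); lia_pos.
move=> q; rewrite !inE negb_and negbK => /orP[/eqP Eq|qA].
  exists (content c - 1), c.1; split.
  - by rewrite Eq.
  - by rewrite cE addrK -g0; apply: mono; lia_pos.
  - by rewrite cE' gtrBl.
  by move=> d lt dS dmax; rewrite subrK; exact: next.
have [y [R [Ey le_y lt_y Hy]]] := Hq _ qA.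
exists y, R; split=> //.
  by have := mono i i.+1 (leqnSn i) lt_i R; lia_pos.
move=> d lt dS dmax; have := next d lt dS dmax; have := Hy c lt_i cS cmax; lia_pos.
Qed.

Close Scope ring_scope.

Theorem theorem3p1 (k : nat) (hk : 0 < k) (l : nat) (hl : 0 < l <= k)
    (la nu : seq nat) (hla : is_core k.+1 la) (hnu : is_core k.+1 nu) :
  bottom_strong_strip k l la nu <-> weak_strip k l nu la.
Proof. by rewrite bottom_strong_stripP // weak_stripP. Qed.
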